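(* Let $H$ be a Hilbert space, let $(\hat X_t)_{t\ge 0}$ be a jump Markov process on $H$ with generator $\mathcal{L}$ and random initial value $\hat X_0$, and let $(X_t)_{t\ge 0}$ be the deterministic process in $H$ with deterministic initial value $X_0$ solving the differential equation $\frac{d}{dt}X_t=(\mathcal{L}I)(X_t)$, where $I$ is the identity map of $H$. Suppose that there is $\kappa\in\mathbb{R}$ such that for all $x,h\in H$ $$\big\langle D_x(\mathcal{L}I)\cdot h,\,h\big\rangle\le-\kappa\|h\|^2 ,$$ that all the jumps of $(\hat X_t)$ have amplitude (norm) bounded above by some $L<\infty$, and that for some $V<\infty$ $$\forall x\in H\qquad \mathcal{L}\big(\|\cdot-x\|^2\big)(x)\le V .$$ Then for any $T\ge 0$ and any $\lambda>0$, $$\ln\mathbb{E}\big[\mathcal{U}\big(\lambda(\hat X_T-X_T)\big)\big]\le \ln\mathbb{E}\big[\mathcal{U}\big(\lambda e^{-\kappa T}(\hat X_0-X_0)\big)\big]+\lambda^2\,e_2\big(\lambda e^{2\kappa_-T}L\big)\,e_1(-2\kappa T)\,V\,T .$$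
   Context: $\|\cdot\|$ is the norm of $H$, $\langle\cdot,\cdot\rangle$ its inner product (its real part if $H$ is complex). $\mathcal{U}:H\to\mathbb{R}$ is $\mathcal{U}(x)=e^{\|x\|}+e^{-\|x\|}$. $e_1(t)=(e^t-1)/t$ with $e_1(0)=1$; $e_2(t)=(e^t-1-t)/t^2$ with $e_2(0)=1/2$; $\kappa_-=\max\{-\kappa,0\}$. The generator $\mathcal{L}$ acts on real functions on $H$; for a jump process with jump rates $q(x,dy)$ from $x$ to $y$ it is $\mathcal{L}f(x)=\int (f(y)-f(x))\,q(x,dy)$. It is extended to functions $f:H\to E$ with values in a Banach space $E$ by duality: $\langle\phi,\mathcal{L}f\rangle=\mathcal{L}(\langle\phi,f\rangle)$ for all $\phi\in E'$. Thus $(\mathcal{L}I)(x)=\int(y-x)\,q(x,dy)\in H$, and $\mathcal{L}(\|\cdot-x\|^2)(x)=\int\|y-x\|^2q(x,dy)$. $D_x(\mathcal{L}I)$ denotes the differential of $\mathcal{L}I:H\to H$ at $x$. It is part of the setting that the process $(\hat X_t)$, the map $\mathcal{L}I$ with its differential, and the solution $(X_t)$ are well defined for all times. *)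

(* Defs.v *)
From HB Require Import structures.
From mathcomp Require Import all_boot all_order all_algebra.
From mathcomp Require Import all_classical all_reals all_analysis.
From mathcomp Require Import measurable_realfun.

Set Implicit Arguments.
Unset Strict Implicit.
Unset Printing Implicit Defensive.

Import Order.TTheory GRing.Theory Num.Theory.
Import numFieldNormedType.Exports.

Local Open Scope classical_set_scope.
Local Open Scope ring_scope.

(* A real Hilbert space is a complete normed module [H] together with an inner
   product [dot : {dot H for idfun}] that induces its norm.  A complex Hilbert
   space is covered through its underlying real space, with the real part of
   the Hermitian product as [dot]. *)
Definition hilbert_dot (R : realType) (H : completeNormedModType R)
    (dot : {dot H for @idfun R}) : Prop :=
  forall x : H, dot x x = `|x| ^+ 2.

Definition borelType (R : realType) (H : completeNormedModType R) :=
  g_sigma_algebraType (@open H).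

Section elementary_functions.
Variable R : realType.
Implicit Types t k : R.

Definition e1 t : R := if t == 0 then 1 else (expR t - 1) / t.

Definition e2 t : R := if t == 0 then 2^-1 else (expR t - 1 - t) / t ^+ 2.

Definition neg_part k : R := Num.max (- k) 0.

Definition calU (H : completeNormedModType R) (x : H) : R :=
  expR `|x| + expR (- `|x|).

End elementary_functions.

Section generator.
Context (R : realType) (H : completeNormedModType R).
(* [R.-ftker] requires each [q x] to be a finite measure, but puts no uniform
   bound on the total rates [q x setT]. *)
Variable q : R.-ftker (borelType H) ~> (borelType H).

Definition gen (f : H -> R) (x : H) : \bar R :=
  (\int[q x]_y (f y - f x)%:E)%E.

(* [g] is the generator applied to the vector-valued map [f], by duality. *)
Definition is_vgen (E : normedModType R) (f g : H -> E) : Prop :=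
  forall phi : {scalar E}, continuous (phi : E -> R) -> forall x : H,
    (q x).-integrable setT (fun y => (phi (f y) - phi (f x))%:E) /\
    ((phi (g x))%:E = gen (phi \o f) x).

End generator.

(* Derivative relative to [0, +oo[: one-sided at time 0. *)
Definition solves_ode (R : realType) (H : completeNormedModType R)
    (F : H -> H) (X : R -> H) : Prop :=
  forall t : R, 0 <= t ->
    (fun h => h^-1 *: (X (t + h) - X t)) @ within (fun h => 0 <= t + h) 0^'
      --> F (X t).

Section jump_process.
Context d (T : measurableType d) (R : realType) (H : completeNormedModType R).
Variables (P : probability T R) (q : R.-ftker (borelType H) ~> (borelType H)).

(* Sigma-algebra generated by the states Y_0, ..., Y_n and the holding times
   W_0, ..., W_(n-1). *)
Definition history (Y : nat -> T -> borelType H) (W : nat -> T -> \bar R)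
    (n : nat) : set (set T) :=
  <<s (\bigcup_(k in `I_n.+1) preimage_set_system setT (Y k) measurable)
      `|` (\bigcup_(k in `I_n) preimage_set_system setT (W k) measurable) >>.

(* Conditionally on the history up to the n-th jump, the holding time W_n and
   the next state Y_(n+1) are independent, with respective laws the exponential
   law of parameter c and the measure q (Y_n, .) / c, where c is the total jump
   rate q (Y_n, H).  If c = 0 the right-hand side is 0, so that W_n = +oo almost
   surely and the state Y_n is absorbing. *)
Definition jump_hold_law (Y : nat -> T -> borelType H) (W : nat -> T -> \bar R)
    : Prop :=
  forall (n : nat) (B : set T) (t : R) (A : set (borelType H)),
    history Y W n B -> 0 <= t -> measurable A ->
    P (B `&` [set w | (W n w <= t%:E)%E] `&` (Y n.+1 @^-1` A)) =
    (\int[P]_(w in B)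
       let c := fine (q (Y n w) setT) in
       ((1 - expR (- (c * t))) * (fine (q (Y n w) A) / c))%:E)%E.

Definition jump_time (W : nat -> T -> \bar R) (n : nat) (w : T) : \bar R :=
  (\sum_(k < n) W k w)%E.

(* Non-explosive, time-homogeneous jump Markov process with jump rates q(x, dy)
   and arbitrary initial law, by its jump chain and holding times: the paths are
   right-continuous step functions given by the successive states Y and holding
   times W, and the jump times tend to infinity.  The Markov property follows
   from jump_hold_law and the memorylessness of the exponential laws.
   The values of Xh at negative times are irrelevant. *)
Definition jump_markov_process (Xh : R -> T -> borelType H) : Prop :=
  (forall t, 0 <= t -> measurable_fun setT (Xh t)) /\
  exists (Y : nat -> T -> borelType H) (W : nat -> T -> \bar R),
    [/\ (forall n, measurable_fun setT (Y n)),
        (forall n, measurable_fun setT (W n) /\ forall w, (0 <= W n w)%E),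
        jump_hold_law Y W,
        {ae P, forall w, jump_time W n w @[n --> \oo] --> +oo%E} &
        {ae P, forall w, forall (n : nat) (t : R),
          (jump_time W n w <= t%:E < jump_time W n.+1 w)%E ->
          Xh t w = Y n w}].

(* Almost surely, |Xh_t - Xh_(t-)| <= L for all t > 0. *)
Definition jumps_bounded (Xh : R -> T -> borelType H) (L : R) : Prop :=
  {ae P, forall w, forall (t : R) (l : H), 0 < t ->
    (Xh s w : H) @[s --> t^'-] --> l -> `|(Xh t w : H) - l| <= L}.

End jump_process.

(* Main.v *)
Require Import Defs.
From HB Require Import structures.
From mathcomp Require Import all_boot all_order all_algebra.
From mathcomp Require Import all_classical all_reals all_analysis.
From mathcomp Require Import measurable_realfun giry ring lra.
Set Implicit Arguments.
Unset Strict Implicit.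
Unset Printing Implicit Defensive.
Import Order.TTheory GRing.Theory Num.Theory.
Import numFieldNormedType.Exports.
Local Open Scope classical_set_scope.
Local Open Scope ring_scope.

(* Idea.  Let [lam t = lambda * expR (- kappa * (T - t))], let [C] be a primitive
   of [K * lam ^+ 2] with [K = e2 M * V] and
   [M = lambda * expR (2 * neg_part kappa * T) * L], and put
   [lyap t y = U (lam t *: (y - X t)) * expR (- C t)].  A second order expansion of
   [U] and the polarization identity show that a jump [y - x] changes [U] by its
   linear part plus at most [U * e2 M * (lam * `|y - x|) ^+ 2]; the linear part
   combines with the drift of [X t] into a term which is nonpositive because [LI]
   is dissipative, with constant [- kappa].  Hence the time derivative of
   [lyap] plus its generator is nonpositive.  No Markov semigroup is needed: by
   integrating this over the exponential holding time of the n-th state, the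
   expectation of [lyap] at time [min T tau_n], [tau_n] being the n-th jump
   time, does not increase with n.  As n tends to infinity, this gives
   [E lyap T (Xh T) <= E lyap 0 (Xh 0)], which is the claim after taking
   logarithms. *)

(** * Exponential inequalities *)

(** Two obstacles shape the proof. First, no expectation is known to be finite. Hence the generator
    inequality is kept as a bound on the integral of the positive function [lyap], expectations are
    compared as integrals of nonnegative extended functions, and they are subtracted only after a
    truncation. Second, the bound [L] is a property of the paths, not of the kernel [q]. It passes
    to [q] only almost surely and only at the states that the process visits, so the generator
    estimate is stated at a single state [x], under the hypothesis that [q x] does not charge the
    excessive jumps. For that hypothesis the size of a jump is measured by the change of the
    distance to [Xt t]: this is all that the radial part of the expansion requires, and it is
    measurable for a fixed centre. The exceptional null set would then depend on [t]; it is made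
    uniform by taking rational times first and using the continuity of [Xt]. *)

Lemma is_derive_ge0_le (R : realType) (f df : R -> R) (a b : R) :
  (forall x : R, is_derive x 1 f (df x)) -> (forall x, a < x -> 0 <= df x) ->
  a <= b -> f a <= f b.
Proof.
move=> fdf df0 ab.
have cf : {within `[a, b], continuous f}.
  apply: continuous_subspaceT => x.
  exact/differentiable_continuous/derivable1_diffP/ex_derive.
have fdf' x : x \in `]a, b[%R -> is_derive x 1 f (df x) by [].
have := ab; rewrite le_eqVlt => /predU1P[->//|ltab].
have [c + fE] := MVT ltab fdf' cf.
rewrite in_itv/= => /andP[ac _].
by rewrite -subr_ge0 fE mulr_ge0 ?df0// subr_ge0.
Qed.

Section exponential_inequalities.
Variable R : realType.
Implicit Types r x y : R.

Definition exp_excess x := expR x - 1 - x.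

Lemma mul_expR_le1 x : (1 - x) * expR x <= 1.
Proof.
have := expR_ge1Dx (- x); rewrite expRN => h.
by rewrite -ler_pdivlMr ?expR_gt0// div1r.
Qed.

Lemma exp_excess_ge0 x : 0 <= exp_excess x.
Proof. by rewrite /exp_excess; have := expR_ge1Dx x; lra. Qed.

Lemma exp_excessN_le x : 0 <= x -> exp_excess (- x) <= exp_excess x.
Proof.
move=> x0; rewrite /exp_excess.
have H y : is_derive y 1 (fun y => expR y - expR (- y) - 2 * y)
   (expR y + expR (- y) - 2).
  by apply: is_derive_eq; rewrite !scaler1 ?mulr1 ?scalerN1 ?mulrN1; lra.
have := is_derive_ge0_le H _ x0; rewrite mulr0 oppr0 expR0.
suff : forall y, 0 < y -> 0 <= expR y + expR (- y) - 2.
  by move=> /[swap] /[apply]; lra.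
move=> y _; have := expR_ge1Dx y; have := expR_ge1Dx (- y); lra.
Qed.

Lemma exp_excess_le_norm x : exp_excess x <= exp_excess `|x|.
Proof.
have [x0|x0] := leP 0 x; first by rewrite ger0_norm.
by rewrite ltr0_norm// -{1}(opprK x) exp_excessN_le// oppr_ge0 ltW.
Qed.

Lemma exp_excess_ge x : 0 <= x -> x ^+ 2 / 2 <= exp_excess x.
Proof.
move=> x0; rewrite /exp_excess.
have H y : is_derive y 1 (fun y => expR y - 1 - y - y ^+ 2 / 2)
   (expR y - 1 - y).
  by apply: is_derive_eq; rewrite /GRing.scale/=; lra.
have := is_derive_ge0_le H _ x0; rewrite expR0 expr0n/= mul0r.
suff : forall y, 0 < y -> 0 <= expR y - 1 - y.
  by move=> /[swap] /[apply]; lra.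
by move=> y _; have := expR_ge1Dx y; lra.
Qed.

Lemma exp_excess_le x : 0 <= x -> exp_excess x <= x ^+ 2 / 2 * expR x.
Proof.
move=> x0; rewrite /exp_excess.
have H y : is_derive y 1 (fun y => y ^+ 2 / 2 * expR y - (expR y - 1 - y))
   (y * expR y + y ^+ 2 / 2 * expR y - expR y + 1).
  by apply: is_derive_eq; rewrite /GRing.scale/=; lra.
have := is_derive_ge0_le H _ x0; rewrite expR0 expr0n/= !mul0r.
suff : forall y, 0 < y -> 0 <= y * expR y + y ^+ 2 / 2 * expR y - expR y + 1.
  by move=> /[swap] /[apply]; lra.
move=> y _; have := mul_expR_le1 y.
have := mulr_ge0 (sqr_ge0 y) (expR_ge0 y); lra.
Qed.

Lemma exp_excess2_le x : 0 <= x -> 2 * exp_excess x <= x * (expR x - 1).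
Proof.
move=> x0; rewrite /exp_excess.
have H y : is_derive y 1 (fun y => y * (expR y - 1) - 2 * (expR y - 1 - y))
   (1 - (1 - y) * expR y).
  by apply: is_derive_eq; rewrite /GRing.scale/=; lra.
have := is_derive_ge0_le H _ x0; rewrite expR0 mul0r.
suff : forall y, 0 < y -> 0 <= 1 - (1 - y) * expR y.
  by move=> /[swap] /[apply]; lra.
by move=> y _; have := mul_expR_le1 y; lra.
Qed.

(** The quotient [exp_excess x / x ^+ 2] is nondecreasing; multiplying out avoids dividing by 0. The
    difference of the two sides, as a function of the larger argument, vanishes at [x] and has
    derivative [h]. In turn [h] is nonnegative at [x] by [exp_excess2_le] and nondecreasing beyond
    it by [exp_excess_le]. *)
Lemma exp_excess_mono x y : 0 <= x -> x <= y ->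
  y ^+ 2 * exp_excess x <= x ^+ 2 * exp_excess y.
Proof.
move=> x0 xy.
pose h z := x ^+ 2 * (expR z - 1) - 2 * z * exp_excess x.
have Hh (z : R) : is_derive z 1 h (x ^+ 2 * expR z - 2 * exp_excess x).
  by apply: is_derive_eq; rewrite /GRing.scale/=; lra.
have h0 (z : R) : x < z -> 0 <= h z.
  move=> xz; apply: (@le_trans _ _ (h x)).
    rewrite /h; have := ler_wpM2l x0 (exp_excess2_le x0).
    by rewrite mulrA; lra.
  apply: (is_derive_ge0_le Hh) => [w xw|]; last exact: ltW.
  have := exp_excess_le x0.
  have : expR x <= expR w by rewrite ler_expR ltW.
  by move=> /(ler_wpM2l (sqr_ge0 x)); lra.
have Hg (z : R) : is_derive z 1
    (fun z => x ^+ 2 * (expR z - 1 - z) - z ^+ 2 * exp_excess x) (h z).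
  by apply: is_derive_eq; rewrite /h /GRing.scale/=; lra.
by have := is_derive_ge0_le Hg h0 xy; rewrite /exp_excess; lra.
Qed.

Lemma e2_ge_half y : 0 <= y -> 2^-1 <= e2 y.
Proof.
rewrite /e2; case: eqP => // /eqP y0 yge0.
have y2 : 0 < y ^+ 2 by rewrite exprn_gt0// lt0r y0.
by rewrite ler_pdivlMr//; have := exp_excess_ge yge0; rewrite /exp_excess; lra.
Qed.

(** [e2 y] is the value at [y] of the monotone quotient [exp_excess x / x ^+ 2]. A negative [x] is
    replaced by its absolute value, which only increases the excess. *)
Lemma exp_excess_le_e2 x y : `|x| <= y -> exp_excess x <= e2 y * x ^+ 2.
Proof.
move=> xy; apply: (le_trans (exp_excess_le_norm x)).
rewrite -[x ^+ 2]ger0_norm ?sqr_ge0// normrX /e2.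
case: eqP => [y0|/eqP y0].
  have -> : `|x| = 0 by apply/le_anti; rewrite normr_ge0 -y0 xy.
  by rewrite /exp_excess expR0 !subrr expr0n mulr0.
have y2 : 0 < y ^+ 2 by rewrite exprn_even_gt0.
have := exp_excess_mono (normr_ge0 x) xy.
rewrite /exp_excess => h.
have -> : (expR y - 1 - y) / y ^+ 2 * `|x| ^+ 2 =
    (`|x| ^+ 2 * (expR y - 1 - y)) / y ^+ 2 by ring.
by rewrite ler_pdivlMr// mulrC.
Qed.

Definition cosh2 r := expR r + expR (- r).

(** This is [2 * sinh r / r]: the gradient of [cosh2] of the norm at [z] is [sinhc2] of the norm
    times [z]. The value 2 at 0 extends it continuously, which is why that function is smooth at the
    origin although the norm is not. *)
Definition sinhc2 r := if r == 0 then 2 else (expR r - expR (- r)) / r.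

Lemma sinhc2M r : sinhc2 r * r = expR r - expR (- r).
Proof.
rewrite /sinhc2; case: eqP => [->|/eqP r0]; last by rewrite divfK.
by rewrite mulr0 oppr0 subrr.
Qed.

Lemma cosh2_gt0 r : 0 < cosh2 r.
Proof. by rewrite /cosh2 addr_gt0 ?expR_gt0. Qed.

Lemma cosh2_ge2 r : 2 <= cosh2 r.
Proof.
by rewrite /cosh2; have := expR_ge1Dx r; have := expR_ge1Dx (- r); lra.
Qed.

Lemma sinhc2_ge0 r : 0 <= r -> 0 <= sinhc2 r.
Proof.
rewrite /sinhc2; case: eqP => // /eqP r0 rge0.
by rewrite divr_ge0// subr_ge0 ler_expR; lra.
Qed.

Lemma sinhc2_le r : 0 <= r -> sinhc2 r <= cosh2 r.
Proof.
rewrite /sinhc2 /cosh2; case: eqP => [->|/eqP r0] rge0.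
  by rewrite oppr0 expR0; lra.
have rgt0 : 0 < r by rewrite lt0r r0.
rewrite ler_pdivrMr//.
have H y : is_derive y 1 (fun y => (expR y + expR (- y)) * y - (expR y - expR (- y)))
   (y * (expR y - expR (- y))).
  by apply: is_derive_eq; rewrite /GRing.scale/=; lra.
have := is_derive_ge0_le H _ rge0; rewrite oppr0 expR0 mulr0.
suff : forall y, 0 < y -> 0 <= y * (expR y - expR (- y)).
  by move=> /[swap] /[apply]; lra.
by move=> y y0; apply: mulr_ge0; [exact: ltW|rewrite subr_ge0 ler_expR; lra].
Qed.

(* Second order expansion of the function [cosh2 `|z|] of a vector [z] in terms
   of [r = `|z|], [r' = `|z'|] and [D = `|z' - z|], where
   [<z, z' - z> = (r' ^+ 2 - r ^+ 2 - D ^+ 2) / 2]. *)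
Lemma cosh2_expansion r r' D y : 0 <= r -> 0 <= D -> `|r' - r| <= D ->
  `|r' - r| <= y ->
  0 <= cosh2 r' - cosh2 r - sinhc2 r * ((r' ^+ 2 - r ^+ 2 - D ^+ 2) / 2)
    <= cosh2 r * e2 y * D ^+ 2.
Proof.
move=> r0 D0 rD ry.
set del := r' - r in rD ry *.
have y0 : 0 <= y by apply: le_trans ry.
have del2 : del ^+ 2 <= D ^+ 2 by rewrite -[leLHS]real_normK ?num_real// lerXn2r ?nnegrE.
(* The remainder is split into a radial part, exact because [r' = r + del], and a part due to the
   change of direction, carried by what [D ^+ 2] has in excess of [del ^+ 2]. *)
have -> : cosh2 r' - cosh2 r - sinhc2 r * ((r' ^+ 2 - r ^+ 2 - D ^+ 2) / 2) =
  (expR r * exp_excess del + expR (- r) * exp_excess (- del)) +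
  sinhc2 r * ((D ^+ 2 - del ^+ 2) / 2).
  have -> : (r' ^+ 2 - r ^+ 2 - D ^+ 2) / 2 =
    r * del - (D ^+ 2 - del ^+ 2) / 2 by rewrite /del; field.
  rewrite mulrBr mulrA sinhc2M /exp_excess /cosh2.
  have -> : r' = r + del by rewrite /del; ring.
  by rewrite opprD !expRD; ring.
have k0 := sinhc2_ge0 r0; have k1 := sinhc2_le r0.
apply/andP; split.
  have d2 : 0 <= (D ^+ 2 - del ^+ 2) / 2 by rewrite divr_ge0// subr_ge0.
  apply: addr_ge0; last exact: mulr_ge0.
  by apply: addr_ge0; apply: mulr_ge0; rewrite ?expR_ge0 ?exp_excess_ge0.
have E1 := ler_wpM2l (expR_ge0 r) (exp_excess_le_e2 ry).
rewrite -normrN in ry.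
have E2 := ler_wpM2l (expR_ge0 (- r)) (exp_excess_le_e2 ry).
have d0 : 0 <= (D ^+ 2 - del ^+ 2) by rewrite subr_ge0.
have c0 := cosh2_gt0 r.
(* The directional part obeys the same bound as the radial one: [sinhc2 r <= cosh2 r], and the
   factor 1/2 is at most [e2 y]. *)
have E3 : sinhc2 r * ((D ^+ 2 - del ^+ 2) / 2) <=
    cosh2 r * ((D ^+ 2 - del ^+ 2) * e2 y).
  rewrite ler_pM// ?divr_ge0// ler_wpM2l// e2_ge_half//.
rewrite /cosh2 in E3 *; rewrite sqrrN in E2; lra.
Qed.

(** Only the point 0 is delicate: the nearby values are difference quotients at 0 of
    [expR y - expR (- y)], whose derivative there is 2. *)
Lemma continuous_sinhc2 : continuous sinhc2.
Proof.
move=> r; have [->|r0] := eqVneq r 0.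
  have H : is_derive (0 : R) 1 (fun y : R => expR y - expR (- y)) 2.
    by apply: is_derive_eq; rewrite /GRing.scale/= oppr0 expR0; lra.
  case: (H) => /cvg_ex[/= l Hl] dE.
  have lE : l = 2.
    by rewrite -dE; apply/esym/cvg_lim => //.
  rewrite {}lE in Hl.
  apply/cvgrPdist_le => e e0.
  move/cvgrPdist_le : Hl => /(_ _ e0).
  rewrite /dnbhs near_withinE => He; near=> y.
  have hy : y != 0 -> `|2 - y^-1 *: (expR (y *: 1 + 0) - expR (- (y *: 1 + 0))
      - (expR 0 - expR (- 0)))| <= e by near: y.
  have -> : sinhc2 0 = 2 by rewrite /sinhc2 eqxx.
  rewrite /sinhc2; case: eqP => [_|/eqP y0]; first by rewrite subrr normr0 ltW.
  move: (hy y0); rewrite oppr0 expR0 subrr subr0 /GRing.scale/= mulr1 addr0.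
  by rewrite mulrC.
have nE : {near r, (fun y => (expR y - expR (- y)) / y) =1 sinhc2}.
  have : \forall y \near r, y != 0 by exact: (open_nbhs_nbhs (conj (@open_neq _ _) r0)).
  apply: filterS => y y0.
  by rewrite /sinhc2 (negbTE y0).
rewrite /continuous_at {2}/sinhc2 (negbTE r0).
apply: (cvg_trans (near_eq_cvg nE)).
apply: cvgM; last exact: cvgV.
apply: cvgB; first exact: continuous_expR.
have : derivable (fun y : R => expR (- y)) r 1 by [].
by move/derivable1_diffP/differentiable_continuous.
Unshelve. all: by end_near. Qed.

End exponential_inequalities.

(** * Inner products and dissipative vector fields *)

Section hilbert.
Variables (R : realType) (H : completeNormedModType R).
Variables (dot : {dot H for @idfun R}) (Hdot : hilbert_dot dot).
Implicit Types x y z h : H.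

Lemma dotC x y : dot x y = dot y x.
Proof. by rewrite hermC/= expr0 mul1r. Qed.

Lemma dotDr x y z : dot x (y + z) = dot x y + dot x z.
Proof. exact: raddfD. Qed.

Lemma dotBr x y z : dot x (y - z) = dot x y - dot x z.
Proof. exact: raddfB. Qed.

Lemma dotZr x (a : R) y : dot x (a *: y) = a * dot x y.
Proof. exact: linearZ. Qed.

Lemma dotBl x y z : dot (x - y) z = dot x z - dot y z.
Proof. by rewrite dotC dotBr !(dotC z). Qed.

Lemma dotZl (a : R) x y : dot (a *: x) y = a * dot x y.
Proof. by rewrite dotC dotZr dotC. Qed.

Lemma dot_polarization x y :
  dot x (y - x) = (`|y| ^+ 2 - `|x| ^+ 2 - `|y - x| ^+ 2) / 2.
Proof. by rewrite -!Hdot !dotBr !dotBl (dotC y x); field. Qed.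

Lemma dot_norm x y : dot x y = (`|x + y| ^+ 2 - `|x| ^+ 2 - `|y| ^+ 2) / 2.
Proof.
by rewrite -!Hdot dotDr !(dotC (x + y)) !dotDr (dotC y x); field.
Qed.

(** Cauchy-Schwarz comes from the triangle inequality, squared and expanded, since the norm is given
    beforehand as a norm. Applying it to [- y] as well yields the absolute value. *)
Lemma norm_dot_le x y : `|dot x y| <= `|x| * `|y|.
Proof.
have le z : dot x z <= `|x| * `|z|.
  have : `|x + z| ^+ 2 <= (`|x| + `|z|) ^+ 2.
    by rewrite lerXn2r ?nnegrE ?addr_ge0// ler_normD.
  rewrite -Hdot dotDr !(dotC (x + z)) !dotDr !Hdot (dotC z x); lra.
rewrite ler_norml le andbT lerNl.
by have := le (- y); rewrite normrN raddfN.
Qed.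

Lemma continuous_dot x : continuous (dot x : H -> R).
Proof.
move=> y; apply/cvgrPdist_le => e e0.
near=> z.
rewrite -dotBr; apply: (le_trans (norm_dot_le _ _)).
have lt : `|y - z| <= e / (`|x| + 1).
  near: z; apply: cvgr_dist_le => //.
  by rewrite divr_gt0// ltr_wpDl.
rewrite (le_trans (ler_wpM2l (normr_ge0 x) lt))//.
rewrite mulrCA ler_piMr ?(ltW e0)// ler_pdivrMr ?ltr_wpDl//; lra.
Unshelve. all: by end_near. Qed.

(** The bound on the differential is integrated along the segment from [y] to [x]: it makes [f]
    nondecreasing, and [f 0 <= f 1] is the claim. *)
Lemma dissipative_of_diff (F : H -> H) (kappa : R) :
  (forall x, differentiable F x) ->
  (forall x h, dot ('d F x h) h <= - kappa * `|h| ^+ 2) ->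
  forall x y, dot (x - y) (F x - F y) <= - kappa * `|x - y| ^+ 2.
Proof.
move=> dF Fk x y; set h := x - y.
pose f (s : R) := kappa * `|h| ^+ 2 * - s - dot h (F (y + s *: h)).
pose df (s : R) := - kappa * `|h| ^+ 2 - dot h ('d F (y + s *: h) h).
have Hf (s : R) : is_derive s 1 f (df s).
  apply: is_deriveB.
    by apply: is_derive_eq; rewrite /GRing.scale/=; lra.
  have := @diff_derivable _ _ _ F (y + s *: h) h (dF _).
  have := @deriveE _ _ _ F (y + s *: h) h (dF _).
  move=> <- dv.
  have K : (fun e : R => e^-1 *: ((fun s => dot h (F (y + s *: h)))
              (e *: (1 : R) + s) - dot h (F (y + s *: h)))) @ 0^' -->
      dot h ('D_h F (y + s *: h)).
    have := cvg_comp _ _ dv (@continuous_dot h _).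
    apply: cvg_trans; apply: near_eq_cvg; near=> e.
    have e1E : e *: (1 : R) = e by exact: mulr1.
    by rewrite /= dotZr dotBr e1E scalerDl (addrCA y).
  split; first exact: (cvgP _ K).
  exact: cvg_lim K.
have := is_derive_ge0_le Hf _ (@ler01 R).
have xE : y + h = x by rewrite /h addrC subrK.
rewrite /f scale0r addr0 scale1r xE oppr0 mulr0 => fle.
rewrite dotBr.
suff : forall s, 0 < s -> 0 <= df s by move=> /fle; lra.
by move=> s _; rewrite /df subr_ge0 dotC.
Unshelve. all: by end_near. Qed.

End hilbert.

(** Prolonging the path before time 0 by its tangent line gives a two-sided derivative at every
    time, and one that is continuous in time when [F] is. Calculus on the whole line then applies
    without a boundary case at 0. *)
Lemma solves_ode_extension (R : realType) (H : completeNormedModType R)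
    (F : H -> H) (X : R -> H) : solves_ode F X ->
  exists Xt : R -> H, (forall t, 0 <= t -> Xt t = X t) /\
    forall t : R, is_derive t 1 Xt (F (Xt (Num.max 0 t))).
Proof.
move=> HX; pose Xt (t : R) := if 0 <= t then X t else X 0 + t *: F (X 0).
have XtE t : 0 <= t -> Xt t = X t by rewrite /Xt => ->.
exists Xt; split => // t.
have K : (fun e : R => e^-1 *: (Xt (e *: (1 : R) + t) - Xt t)) @ 0^' -->
    F (Xt (Num.max 0 t)).
  have eE (e : R) : e *: (1 : R) = e by exact: mulr1.
  have [t0|t0] := leP 0 t; last first.
    rewrite (XtE 0)//; apply/cvgrPdist_le => e e0.
    rewrite /dnbhs near_withinE.
    near=> h => h0.
    have th : h + t < 0.
      rewrite -ltrBrDr sub0r; near: h; apply: lt_nbhsl.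
      by rewrite oppr_gt0.
    have -> : Xt (h *: (1 : R) + t) = X 0 + (h + t) *: F (X 0).
      by rewrite eE /Xt leNgt th.
    have -> : Xt t = X 0 + t *: F (X 0) by rewrite /Xt leNgt t0.
    rewrite opprD addrACA subrr add0r -scalerBl addrK.
    by rewrite scalerA mulVf// scale1r subrr normr0 ltW.
  rewrite XtE//; apply/cvgrPdist_le => e e0.
  have /(@cvgrPdist_le _ _ _ _ (within_filter _ _)) := HX t t0.
  move=> /(_ _ e0); rewrite near_withinE /dnbhs !near_withinE => He.
  have Ht : \forall h \near (0:R), - t < h \/ t = 0.
    have := t0; rewrite le_eqVlt => /predU1P[<-|tgt0].
      by near=> h; right.
    near=> h; left; near: h; apply: lt_nbhsr; rewrite oppr_lt0//.
  move: He Ht; apply: filterS2 => h He Ht h0.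
  rewrite eE.
  have [th|th] := leP 0 (t + h).
    rewrite XtE; last by rewrite addrC.
    by rewrite (addrC h); exact: He.
  case: Ht => [|tE]; first by rewrite ltNge; move: th; lra.
  move: th; rewrite tE addr0 add0r => th.
  have -> : Xt h = X 0 + h *: F (X 0) by rewrite /Xt leNgt th.
  rewrite (addrC (X 0)) addrK.
  by rewrite scalerA mulVf// scale1r subrr normr0 ltW.
split; first exact: (cvgP _ K).
exact: cvg_lim K.
Unshelve. all: by end_near. Qed.

Section derivative_along_paths.
Variables (R : realType) (H : completeNormedModType R).
Variables (dot : {dot H for @idfun R}) (Hdot : hilbert_dot dot).

Lemma cosh2_norm_expansion (z z' : H) y : `| `|z'| - `|z| | <= y ->
  0 <= cosh2 `|z'| - cosh2 `|z| - sinhc2 `|z| * dot z (z' - z)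
    <= cosh2 `|z| * e2 y * `|z' - z| ^+ 2.
Proof.
move=> zy; rewrite dot_polarization//.
by apply: cosh2_expansion => //; exact: ler_dist_dist.
Qed.

(** The chain rule through the norm fails where [Z t = 0]. Instead, [cosh2_norm_expansion] bounds
    the remainder of the linear approximation by a constant times the squared increment of [Z],
    hence by o(e). The radius 1 used there is arbitrary. *)
Lemma is_derive_cosh2_norm (Z : R -> H) (t : R) (dZ : H) : is_derive t 1 Z dZ ->
  is_derive t 1 (fun s => cosh2 `|Z s|) (sinhc2 `|Z t| * dot (Z t) dZ).
Proof.
move=> HZ; have cZ : {for t, continuous Z}.
  exact/differentiable_continuous/derivable1_diffP/ex_derive.
have dvZ : (fun e : R => e^-1 *: (Z (e *: (1 : R) + t) - Z t)) @ 0^' --> dZ.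
  by case: HZ => dv <-; exact: dv.
have tE : (fun e : R => e *: (1 : R) + t) @ 0^' --> t.
  have c0 : {for (0 : R), continuous (fun e : R => e *: (1 : R) + t)}.
    exact/differentiable_continuous/derivable1_diffP/ex_derive.
  have -> : t = (0 : R) *: (1 : R) + t by rewrite scale0r add0r.
  rewrite [in X in X --> _]scale0r add0r; exact: cvg_within_filter c0.
have Zt : (fun e : R => Z (e *: (1 : R) + t) - Z t) @ 0^' --> (0 : H).
  rewrite -(subrr (Z t)); apply: cvgB; last exact: cvg_cst.
  exact: cvg_comp tE cZ.
pose rem (e : R) := cosh2 `|Z (e *: (1 : R) + t)| - cosh2 `|Z t| -
  sinhc2 `|Z t| * dot (Z t) (Z (e *: (1 : R) + t) - Z t).
have remle : \forall e \near 0^', `|e^-1 * rem e| <= cosh2 `|Z t| * e2 1 *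
    (`|e^-1 *: (Z (e *: (1 : R) + t) - Z t)| * `|Z (e *: (1 : R) + t) - Z t|).
  near=> e.
  have Z1 : `|Z (e *: (1 : R) + t) - Z t| <= 1.
    near: e; move/cvgr0Pnorm_le: Zt; apply; exact: ltr01.
  have := @cosh2_norm_expansion (Z t) (Z (e *: (1 : R) + t)) 1
    (le_trans (ler_dist_dist _ _) Z1).
  rewrite -/(rem e) => /andP[r0 r1].
  rewrite normrM (ger0_norm r0) normrZ -(mulrA `|e^-1|) -expr2 mulrCA.
  by rewrite ler_wpM2l.
have rem0 : (fun e => e^-1 * rem e) @ 0^' --> (0 : R).
  apply/norm_cvg0P.
  apply: (squeeze_cvgr (f := fun=> 0)); last 2 first.
  - exact: cvg_cst.
  - have := cvgM (cvg_norm dvZ) (cvg_norm Zt).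
    rewrite normr0 mulr0 => h.
    by have := cvgM (cvg_cst (cosh2 `|Z t| * e2 1)) (h _ _ _); rewrite mulr0; apply.
  by near=> e; rewrite normr_ge0/=; near: e; exact: remle.
have K : (fun e : R => e^-1 *: (cosh2 `|Z (e *: (1 : R) + t)| - cosh2 `|Z t|))
    @ 0^' --> sinhc2 `|Z t| * dot (Z t) dZ.
  have lin := cvg_comp _ _ dvZ (@continuous_dot _ _ _ Hdot (Z t) _).
  have h : (fun e : R => sinhc2 `|Z t| *
        dot (Z t) (e^-1 *: (Z (e *: (1 : R) + t) - Z t)) + e^-1 * rem e) @ 0^' -->
      sinhc2 `|Z t| * dot (Z t) dZ + 0.
    by apply: cvgD rem0; apply: cvgM lin; exact: cvg_cst.
  move: h; rewrite addr0; apply: cvg_trans; apply: near_eq_cvg; near=> e.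
  by rewrite /= dotZr /rem /GRing.scale/=; ring.
split; first exact: (cvgP _ K).
exact: cvg_lim K.
Unshelve. all: by end_near. Qed.
End derivative_along_paths.

(** * The Lyapunov function *)

Lemma is_derive_scale (R : realType) (H : completeNormedModType R)
    (k : R -> R) (W : R -> H) (t dk : R) (dW : H) :
  is_derive t 1 k dk -> is_derive t 1 W dW ->
  is_derive t 1 (fun s => k s *: W s) (dk *: W t + k t *: dW).
Proof.
move=> Hk HW.
have cW : {for t, continuous W}.
  exact/differentiable_continuous/derivable1_diffP/ex_derive.
have dvk : (fun e : R => e^-1 *: (k (e *: (1 : R) + t) - k t)) @ 0^' --> dk.
  by case: Hk => dv <-; exact: dv.
have dvW : (fun e : R => e^-1 *: (W (e *: (1 : R) + t) - W t)) @ 0^' --> dW.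
  by case: HW => dv <-; exact: dv.
have tE : (fun e : R => e *: (1 : R) + t) @ 0^' --> t.
  have c0 : {for (0 : R), continuous (fun e : R => e *: (1 : R) + t)}.
    exact/differentiable_continuous/derivable1_diffP/ex_derive.
  have -> : t = (0 : R) *: (1 : R) + t by rewrite scale0r add0r.
  rewrite [in X in X --> _]scale0r add0r; exact: cvg_within_filter c0.
have K : (fun e : R => e^-1 *: (k (e *: (1 : R) + t) *: W (e *: (1 : R) + t) -
    k t *: W t)) @ 0^' --> dk *: W t + k t *: dW.
  have h : (fun e : R => (e^-1 *: (k (e *: (1 : R) + t) - k t)) *:
        W (e *: (1 : R) + t) + k t *: (e^-1 *: (W (e *: (1 : R) + t) - W t)))
      @ 0^' --> dk *: W t + k t *: dW.
    apply: cvgD; last by apply: cvgZ dvW; exact: cvg_cst.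
    by apply: cvgZ dvk _; exact: cvg_comp tE cW.
  move: h; apply: cvg_trans; apply: near_eq_cvg; near=> e.
  rewrite scalerA mulrC -!scalerA -scalerDr; congr (_ *: _).
  by rewrite scalerBl scalerBr addrA subrK.
split; first exact: (cvgP _ K).
exact: cvg_lim K.
Unshelve. all: by end_near. Qed.

Lemma continuous_borel_measurable (R : realType) (H : completeNormedModType R)
    (f : H -> R) : continuous f ->
  measurable_fun [set: borelType H] (f : borelType H -> R).
Proof.
move=> /continuousP cf; apply: (measurability _ (RGenOpens.measurableE R)).
move=> _ [_ [a [b ->] <-]]; rewrite setTI.
by apply: sub_sigma_algebra; apply: cf; exact: interval_open.
Qed.

(* Candidate supermartingale along the jump process; [C] compensates the
   quadratic variation of the jumps. *)
Definition lyap (R : realType) (H : completeNormedModType R)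
    (lam C : R -> R) (Xt : R -> H) (t : R) (y : H) : R :=
  cosh2 `|lam t *: (y - Xt t)| * expR (- C t).

Section lyapunov.
Variables (R : realType) (H : completeNormedModType R).
Variables (dot : {dot H for @idfun R}) (Hdot : hilbert_dot dot).
Variables (LI : H -> H) (cLI : continuous LI) (kappa : R).
Hypothesis LI_diss : forall x y : H,
  dot (x - y) (LI x - LI y) <= - kappa * `|x - y| ^+ 2.
Variables (lam C : R -> R) (K : R).
Hypothesis lam_gt0 : forall t, 0 < lam t.
Hypothesis lamP : forall t : R, is_derive t 1 lam (kappa * lam t).
Hypothesis CP : forall t : R, is_derive t 1 C (K * lam t ^+ 2).
Variable Xt : R -> H.
Hypothesis XtP : forall t : R, is_derive t 1 Xt (LI (Xt (Num.max 0 t))).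

Definition dlyap (t : R) (x : H) : R :=
  expR (- C t) * (sinhc2 `|lam t *: (x - Xt t)| *
     dot (lam t *: (x - Xt t))
         (kappa *: (lam t *: (x - Xt t)) - lam t *: LI (Xt (Num.max 0 t))) -
     K * lam t ^+ 2 * cosh2 `|lam t *: (x - Xt t)|).

Lemma is_derive_lyap (t : R) (x : H) :
  is_derive t 1 (fun s => lyap lam C Xt s x) (dlyap t x).
Proof.
have HZ : is_derive t 1 (fun s => lam s *: (x - Xt s))
    (kappa *: (lam t *: (x - Xt t)) - lam t *: LI (Xt (Num.max 0 t))).
  have HW : is_derive t 1 (fun s => x - Xt s) (0 - LI (Xt (Num.max 0 t))).
    exact: is_deriveB.
  have := is_derive_scale (lamP t) HW.
  by rewrite sub0r scalerN scalerA.
have HU := is_derive_cosh2_norm Hdot HZ.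
have HE : is_derive t 1 (fun s => expR (- C s))
    (expR (- C t) * - (K * lam t ^+ 2)).
  have HN := is_deriveN (CP t).
  apply: is_derive_eq.
  by rewrite /GRing.scale/= mulrC.
rewrite /lyap; apply: is_derive_eq.
by rewrite /dlyap /GRing.scale/=; ring.
Qed.

(** The fundamental theorem of calculus will be applied over a holding time. Continuity of an inner
    product of two moving vectors is reduced to that of norms by polarization. *)
Lemma continuous_dlyap (x : H) : continuous (fun t => dlyap t x).
Proof.
have cXt : continuous Xt.
  move=> t; exact/differentiable_continuous/derivable1_diffP/ex_derive.
have clam : continuous lam.
  move=> t; exact/differentiable_continuous/derivable1_diffP/ex_derive.
have cC : continuous C.
  move=> t; exact/differentiable_continuous/derivable1_diffP/ex_derive.
have cZ : continuous (fun t => lam t *: (x - Xt t)).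
  by move=> t; apply: cvgZ; [exact: clam|apply: cvgB; [exact: cvg_cst|exact: cXt]].
have cexp : continuous (@expR R) := @continuous_expR R.
have cnZ : continuous (fun t => `|lam t *: (x - Xt t)|).
  by move=> t; apply: cvg_norm; exact: cZ.
have cdot (Y W : R -> H) : continuous Y -> continuous W ->
    continuous (fun t => dot (Y t) (W t)).
  move=> cY cW t.
  have -> : (fun t => dot (Y t) (W t)) = (fun t =>
      (`|Y t + W t| ^+ 2 - `|Y t| ^+ 2 - `|W t| ^+ 2) / 2).
    by apply/funext => s; exact: dot_norm.
  apply: cvgM; last exact: cvg_cst.
  have cn2 (f : R -> H) : continuous f -> `|f s| ^+ 2 @[s --> t] --> `|f t| ^+ 2.
    by move=> cf; apply: cvgM; apply: cvg_norm; exact: cf.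
  apply: cvgB; last exact: cn2.
  apply: cvgB; last exact: cn2.
  by apply: (cn2 (fun t => Y t + W t)) => s; apply: cvgD; [exact: cY|exact: cW].
have cF : continuous (fun t : R => LI (Xt (Num.max 0 t))).
  move=> t; apply: (@continuous_comp _ _ _ (fun t : R => Xt (Num.max 0 t))).
    apply: (@continuous_comp _ _ _ (fun t : R => Num.max 0 t)); last exact: cXt.
    by apply: (@continuous_max R R (cst 0) id); [exact: cst_continuous|exact: cvg_id].
  exact: cLI.
have cmp (f g : R -> R) : continuous f -> continuous g -> continuous (g \o f).
  by move=> cf cg t; apply: continuous_comp; [exact: cf|exact: cg].
have cN (f : R -> R) : continuous f -> continuous (fun t => - f t).
  by move=> cf t; apply: cvgN; exact: cf.
move=> t; apply: cvgM; first exact: (cmp _ _ (cN _ cC) cexp).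
apply: cvgB.
  apply: cvgM; first exact: (cmp _ _ cnZ (@continuous_sinhc2 R)).
  apply: cdot => // s; apply: cvgB.
    by apply: cvgZ; [exact: cvg_cst|exact: cZ].
  by apply: cvgZ; [exact: clam|exact: cF].
apply: cvgM.
  by apply: cvgM; [exact: cvg_cst|apply: cvgM; exact: clam].
by apply: cvgD; [exact: (cmp _ _ cnZ cexp)|exact: (cmp _ _ (cN _ cnZ) cexp)].
Qed.

Lemma lyap_gt0 t x : 0 < lyap lam C Xt t x.
Proof. by rewrite mulr_gt0 ?cosh2_gt0// expR_gt0. Qed.

Lemma continuous_lyap t : continuous (lyap lam C Xt t).
Proof.
move=> x; apply: cvgM; last exact: cvg_cst.
have cZ : continuous (fun x => `|lam t *: (x - Xt t)|).
  move=> y; apply: cvg_norm; apply: cvgZ; first exact: cvg_cst.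
  by apply: cvgB; [exact: cvg_id|exact: cvg_cst].
apply: cvgD.
  by apply: continuous_cvg; [exact: continuous_expR|exact: cZ].
by apply: continuous_cvg; [exact: continuous_expR|apply: cvgN; exact: cZ].
Qed.

End lyapunov.

(** * The generator applied to the Lyapunov function *)

Section generator_bound.
Variables (R : realType) (H : completeNormedModType R).
Variables (dot : {dot H for @idfun R}) (Hdot : hilbert_dot dot).
Variables (q : R.-ftker (borelType H) ~> (borelType H)).
Variables (LI : H -> H) (kappa : R).
Hypothesis HLI : is_vgen q (fun x : H => x) LI.
Hypothesis LI_diss : forall x y : H,
  dot (x - y) (LI x - LI y) <= - kappa * `|x - y| ^+ 2.
Variables (V M L : R).
Hypothesis M0 : 0 <= M.
Hypothesis HV : forall x : H, (gen q (fun y : H => `|y - x| ^+ 2)%R x <= V%:E)%E.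
Variables (lam C : R -> R) (Xt : R -> H).
Hypothesis lam_gt0 : forall t, 0 < lam t.

(* The right-hand side is [c * lyap - dlyap], [c] being the total rate, so that
   this is [dlyap + gen lyap <= 0]; the integral form avoids assuming [lyap]
   integrable.  Only the bound on [`|y - Xt t| - `|x - Xt t|] is used, because
   [(x, y) |-> `|y - x|] need not be measurable for the product sigma-algebra
   when [H] is not separable. *)
Lemma generator_lyap_le (t : R) (x : H) : 0 <= t -> lam t * L <= M ->
  q x [set y : borelType H | L < `| `|(y : H) - Xt t| - `|x - Xt t| |] = 0%E ->
  (\int[q x]_y (lyap lam C Xt t y)%:E <=
   (fine (q x setT) * lyap lam C Xt t x -
    dlyap dot LI kappa lam C (e2 M * V)%R Xt t x)%:E)%E.
Proof.
move=> t0 lamL qbad.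
have [z zdef] : exists z : H, z = lam t *: (x - Xt t) by eexists.
set E := expR (- C t); have E0 : 0 < E := expR_gt0 _.
have z0 := normr_ge0 z.
(* [w] is the gradient of [lyap] in the state variable at [x]. Pairing with [w] is the continuous
   functional to which the weak definition of [LI] is applied. *)
pose w : H := (E * sinhc2 `|z| * lam t) *: z.
have cqd : q x setT \is a fin_num by exact: kernel_finite_transition.
have mcont (f : H -> R) : continuous f ->
    measurable_fun [set: borelType H] (f : borelType H -> R).
  exact: continuous_borel_measurable.
have cdist (a : H) : continuous (fun y : H => `|y - a|).
  by move=> y; apply: cvg_norm; apply: cvgB; [exact: cvg_id|exact: cvg_cst].
have cdist2 : continuous (fun y : H => `|y - x| ^+ 2).
  by move=> y; apply: cvgM; exact: cdist.
pose f1 (y : borelType H) := (E * cosh2 `|z|)%:E.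
pose f2 (y : borelType H) := (`|(y : H) - x| ^+ 2)%:E.
pose f3 (y : borelType H) := (dot w (y : H) - dot w x)%:E.
have int1 : (\int[q x]_y f1 y = (E * cosh2 `|z|)%:E * q x setT)%E.
  exact: integral_cst.
have if1 : (q x).-integrable setT f1.
  apply/integrableP; split; first exact: measurable_cst.
  under eq_integral do rewrite /f1 gee0_abs ?lee_fin ?mulr_ge0 ?(ltW E0) ?(ltW (cosh2_gt0 _))//.
  by rewrite int1 ltey_eq fin_numM.
have f20 y : (0 <= f2 y)%E by rewrite lee_fin sqr_ge0.
have mf2 : measurable_fun setT f2.
  by apply/measurable_EFinP; exact: mcont.
have int2 : (\int[q x]_y f2 y <= V%:E)%E.
  apply: le_trans (HV x); rewrite le_eqVlt; apply/orP; left; apply/eqP.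
  by apply: eq_integral => y _; rewrite subrr normr0 expr0n/= subr0.
have if2 : (q x).-integrable setT f2.
  apply/integrableP; split => //.
  under eq_integral do rewrite gee0_abs//.
  by rewrite (le_lt_trans int2)// ltry.
have := HLI (continuous_dot Hdot (x:=w)) x.
move=> [if3 int3].
pose k := cosh2 `|z| * E * e2 M * lam t ^+ 2.
pose B (y : borelType H) := (f1 y + (k%:E * f2 y + f3 y))%E.
have mf3 : measurable_fun setT f3 by case/integrableP : if3.
have zE (y : H) : lam t *: (y - Xt t) - z = lam t *: (y - x).
  by rewrite zdef -scalerBr opprB addrA subrK.
have BE y : B y = (E * (cosh2 `|z| * (1 + e2 M * `|lam t *: ((y : H) - x)| ^+ 2)
    + sinhc2 `|z| * dot z (lam t *: ((y : H) - x))))%:E.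
  rewrite /B /f1 /f2 /f3 -EFinM -!EFinD; congr (_%:E).
  rewrite -(dotBr dot) /w dotZl dotZr normrZ gtr0_norm// /k; ring.
have bad_le : {ae q x, forall y, setT y -> ((lyap lam C Xt t y)%:E <= B y)%E}.
  exists [set y : borelType H | L < `| `|(y : H) - Xt t| - `|x - Xt t| |].
  split => //.
    have mn : measurable_fun setT (fun y : borelType H => `| `|(y : H) - Xt t| - `|x - Xt t| | : R).
      apply: mcont => y; apply: cvg_norm; apply: cvgB; last exact: cvg_cst.
      exact: cdist.
    rewrite -[X in measurable X]setTI.
    have := mn measurableT _ (measurable_itv `]L, +oo[).
    by rewrite /= set_itvoy.
  move=> y /= yB; rewrite ltNge; apply/negP => nL; apply: yB => _.
  rewrite BE lee_fin.
  have := @cosh2_norm_expansion R H dot Hdot z (lam t *: ((y : H) - Xt t)) M.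
  have h : `| `|lam t *: ((y : H) - Xt t)| - `|z| | <= M.
    rewrite zdef !normrZ -mulrBr normrM !(gtr0_norm (lam_gt0 t)).
    apply: le_trans lamL; apply: ler_wpM2l => //; exact: ltW.
  move=> /(_ h) /andP[_]; rewrite zE /lyap -/E => h2.
  by rewrite [leLHS]mulrC ler_pM2l//; lra.
(* Comparison of integrals of nonnegative functions requires the majorant [B] to be nonnegative
   everywhere, even on the null set of excessive jumps. The linear term is at most [cosh2] times the
   norm of [D], and a real [a] satisfies [a <= 1 + a ^+ 2 / 2], where [e2 M] is at least 1/2. *)
have B0 y : (0 <= B y)%E.
  rewrite BE lee_fin mulr_ge0 ?(ltW E0)//.
  set D : H := lam t *: ((y : H) - x).
  have h1 := norm_dot_le Hdot z D.
  have h2 := sinhc2M `|z|.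
  have h3 : `|sinhc2 `|z| * dot z D| <= cosh2 `|z| * `|D|.
    rewrite normrM ger0_norm ?sinhc2_ge0//.
    apply: (le_trans (ler_wpM2l (sinhc2_ge0 z0) h1)).
    rewrite mulrA h2 ler_wpM2r//.
    by rewrite /cosh2; have := expR_ge0 (- `|z|); lra.
  have h4 := e2_ge_half M0.
  have c0 := cosh2_gt0 `|z|.
  have h5 : cosh2 `|z| * `|D| <= cosh2 `|z| * (1 + e2 M * `|D| ^+ 2).
    rewrite ler_pM2l//.
    have := ler_wpM2r (sqr_ge0 `|D|) h4.
    have := sqr_ge0 (`|D| - 1); nra.
  move: h3; rewrite ler_norml => /andP[h3 _]; lra.
have mlyap : measurable_fun setT (fun y : borelType H => (lyap lam C Xt t y)%:E).
  by apply/measurable_EFinP; apply: (mcont (lyap lam C Xt t)); exact: continuous_lyap.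
have if23 : (q x).-integrable setT (fun y => k%:E * f2 y + f3 y)%E.
  by apply: integrableD => //; exact: integrableZl.
have mB : measurable_fun setT B.
  by case/integrableP : (integrableD measurableT if1 if23).
apply: (le_trans (ae_ge0_le_integral measurableT _ mlyap _ mB bad_le)).
- by move=> y _; rewrite lee_fin ltW// lyap_gt0.
- by move=> y _; exact: B0.
rewrite integralD// integralD//; last exact: integrableZl.
rewrite integralZl// int1 -[X in (_ + (_ + X))%E]/(gen q (dot w \o id) x) -int3.
have k0 : 0 <= k.
  have e20 : 0 <= e2 M by apply: le_trans (e2_ge_half M0); rewrite invr_ge0.
  apply: mulr_ge0; last exact: sqr_ge0; apply: mulr_ge0 => //.
  by apply: mulr_ge0; apply: ltW => //; exact: cosh2_gt0.
apply: (@le_trans _ _ ((E * cosh2 `|z|)%:E * q x setT + (k%:E * V%:E +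
    (dot w (LI x))%:E))%E).
  by rewrite leeD2l// leeD2r// lee_wpmul2l// lee_fin.
rewrite -(fineK cqd) -!EFinM -!EFinD lee_fin /= /lyap /dlyap -zdef -/E.
rewrite (max_r t0).
(* The term in [kappa] comes from the growth rate of [lam]; dissipativity between [x] and [Xt t]
   offsets exactly this amount. *)
have diss : lam t * dot z (LI x - LI (Xt t)) + kappa * `|z| ^+ 2 <= 0.
  rewrite zdef dotZl normrZ (gtr0_norm (lam_gt0 t)).
  have := ler_wpM2l (sqr_ge0 (lam t)) (LI_diss x (Xt t)); lra.
have := ler_wpM2l (mulr_ge0 (ltW E0) (sinhc2_ge0 z0)) diss.
rewrite mulr0 /w dotZl !dotBr !dotZr Hdot /k; lra.
Qed.

End generator_bound.

(* With [v] uniform on [0, 1], [- ln v / c] is exponential of parameter [c]; the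
   integrand is dominated by the derivative of [v * f (s - ln v / c)]. *)
Lemma integral_exp_clock_le (R : realType) (f df : R -> R) (h : R -> \bar R)
    (c s T : R) : 0 <= c -> s <= T ->
  (forall t : R, is_derive t 1 f (df t)) -> continuous df ->
  measurable_fun setT h ->
  (forall t, s <= t <= T -> (0 <= h t <= (c * f t - df t)%:E)%E) ->
  ((expR (- (c * (T - s))) * f T)%:E +
   \int[lebesgue_measure]_(v in `[expR (- (c * (T - s))), 1%R])
     (c^-1%:E * h (s - ln v / c)%R) <= (f s)%:E)%E.
Proof.
move=> c0 sT fdf cdf mh hle; set a := expR _.
have a0 : 0 < a := expR_gt0 _.
have cf : continuous f.
  by move=> t; exact/differentiable_continuous/derivable1_diffP/ex_derive.
(* In the degenerate case [v] ranges over the single point 1 and the integral vanishes. If [c = 0],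
   the hypothesis on [h] forces [df <= 0] on [s, T], so that [f T <= f s]. *)
have [cT0|cT0] := eqVneq (c * (T - s)) 0.
  have a1 : a = 1 by rewrite /a cT0 oppr0 expR0.
  rewrite a1 mul1r set_itv1 integral_set1 adde0 lee_fin.
  move/eqP : cT0; rewrite mulf_eq0 subr_eq0 => /orP[/eqP cE|/eqP TE]; last by rewrite TE.
  have H (t : R) : is_derive t 1 (fun u => - f u) (- df t) by exact: is_deriveN.
  have [ltsT|] := ltP s T; last first.
    move=> Ts; have -> : T = s by apply/le_anti; rewrite Ts sT.
    exact: lexx.
  have cNf : {within `[s, T], continuous (fun u => - f u)}.
    by apply: continuous_subspaceT => u; apply: cvgN; exact: cf.
  have [w] := MVT ltsT (fun t _ => H t) cNf.
  rewrite in_itv/= => /andP[sw wT] fE.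
  have := hle w; rewrite (ltW sw) (ltW wT) cE mul0r sub0r => /(_ isT)/andP[h0 h1].
  have := le_trans h0 h1; rewrite lee_fin => dw.
  have := mulr_ge0 dw (_ : 0 <= T - s); rewrite -fE => /(_ (ltW _)).
  by rewrite subr_gt0 => /(_ ltsT); lra.
have cgt0 : 0 < c.
  by rewrite lt0r c0 andbT; apply: contraNneq cT0 => ->; rewrite mul0r.
have ltsT : s < T.
  rewrite lt_neqAle sT andbT; apply: contraNneq cT0 => ->.
  by rewrite subrr mulr0.
have a1 : a < 1 by rewrite /a expR_lt1 oppr_lt0 mulr_gt0// subr_gt0.
pose Phi (v : R) := v * f (s - ln v / c).
pose phi (v : R) := f (s - ln v / c) - c^-1 * df (s - ln v / c).
have dPhi (v : R) : 0 < v -> is_derive v 1 Phi (phi v).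
  move=> v0.
  have dln := is_derive1_ln v0.
  have darg : is_derive v 1 (fun w : R => s - ln w / c) (- (v^-1 / c)).
    apply: is_derive_eq.
    by rewrite /GRing.scale/=; ring.
  have dcomp := is_derive1_comp (fdf _) darg.
  apply: is_derive_eq; rewrite /GRing.scale/= /phi.
  by field; rewrite gt_eqF//= gt_eqF.
have cPhi (v : R) : 0 < v -> {for v, continuous Phi}.
  by move=> v0; have := dPhi v v0 => dv;
    exact/differentiable_continuous/derivable1_diffP/ex_derive.
have carg (v : R) : 0 < v -> {for v, continuous (fun w : R => s - ln w / c)}.
  move=> v0; apply: cvgB; first exact: cvg_cst.
  by apply: cvgM; [exact: continuous_ln|exact: cvg_cst].
have cphi (v : R) : 0 < v -> {for v, continuous phi}.
  move=> v0; apply: cvgB.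
    by apply: continuous_cvg; [exact: cf|exact: carg].
  apply: cvgM; first exact: cvg_cst.
  by apply: continuous_cvg; [exact: cdf|exact: carg].
have FTC : (\int[lebesgue_measure]_(v in `[a, 1%R]) (phi v)%:E =
    (Phi 1)%:E - (Phi a)%:E)%E.
  apply: continuous_FTC2 => //.
  - apply: continuous_in_subspaceT => v; rewrite inE/= in_itv/= => /andP[av _].
    by apply: cphi; exact: lt_le_trans av.
  - split => [v||].
    + rewrite in_itv/= => /andP[av _].
      have := dPhi v (lt_trans a0 av) => dv; exact: ex_derive.
    + by apply: cvg_at_right_filter; exact: cPhi.
    + by apply: cvg_at_left_filter; exact: cPhi.
  - move=> v; rewrite in_itv/= => /andP[av _].
    have := dPhi v (lt_trans a0 av) => dv.
    by rewrite derive1E derive_val.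
have argE v : a <= v <= 1 -> s <= s - ln v / c <= T.
  move=> /andP[av v1].
  have v0 : 0 < v := lt_le_trans a0 av.
  apply/andP; split.
    by rewrite lerBrDl gerDr pmulr_lle0 ?invr_gt0// ln_le0.
  have lv : - (c * (T - s)) <= ln v by rewrite -ler_expR lnK.
  have : 0 <= (ln v + c * (T - s)) / c by rewrite divr_ge0//; lra.
  by rewrite mulrDl (mulrC c) mulfK ?gt_eqF//; lra.
have mg : measurable_fun `[a, 1] (fun v => c^-1%:E * h (s - ln v / c)%R)%E.
  apply: measurable_funeM; apply: measurable_funTS.
  apply: (measurableT_comp mh); apply: measurable_funB => //.
  by apply: measurable_funM => //; exact: measurable_ln.
apply: (@le_trans _ _ ((a * f T)%:E + ((Phi 1)%:E - (Phi a)%:E))%E); last first.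
  rewrite -EFinB -EFinD lee_fin /Phi ln1 mul0r subr0 mul1r.
  have -> : s - ln a / c = T by rewrite /a expRK; field; rewrite gt_eqF.
  lra.
rewrite leeD2l// -FTC; apply: ge0_le_integral => //.
- move=> v /=; rewrite in_itv/= => /argE/hle/andP[h0 _].
  by rewrite mule_ge0// lee_fin invr_ge0.
- apply/measurable_EFinP; apply: subspace_continuous_measurable_fun => //.
  apply: continuous_in_subspaceT => v; rewrite inE/= in_itv/= => /andP[av _].
  by apply: cphi; exact: lt_le_trans av.
- move=> v /=; rewrite in_itv/= => /argE/hle/andP[_ h1].
  apply: (@le_trans _ _ (c^-1%:E * (c * f (s - ln v / c) - df (s - ln v / c))%:E)%E).
    by rewrite lee_wpmul2l// lee_fin invr_ge0.
  by rewrite -EFinM lee_fin /phi mulrBr mulKf ?gt_eqF.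
Qed.

(** * Joint law of a holding time and the next state *)

Section restricted_subprobability.
Context d (T : measurableType d) (R : realType) (P : giry T R).
Variables (D : set T) (mD : measurable D).

Lemma mrestr_le1 : (mrestr P mD setT <= 1)%E.
Proof.
rewrite /mrestr setTI (le_trans _ (sprobability_setT (s := P)))//.
by apply: le_measure => //; rewrite inE.
Qed.

HB.instance Definition _ :=
  Measure_isSubProbability.Build _ _ R (mrestr P mD) mrestr_le1.

(** Elements of [giry] are sub-probabilities, so an event such as a finite holding time is handled
    by restriction, without normalizing. *)
Definition giry_restr : giry T R := mrestr P mD.

Lemma ge0_giry_int_restr (f : T -> \bar R) : measurable_fun setT f ->
  (forall x, 0 <= f x)%E -> giry_int giry_restr f = (\int[P]_(x in D) f x)%E.
Proof.
move=> mf f0; rewrite /giry_int.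
rewrite (@ge0_negligible_integral _ _ _ _ setT (~` D))//; last first.
- by rewrite /giry_restr/= /mrestr setICl measure0.
- exact: measurableC.
rewrite setDE setCK setTI; apply: eq_measure_integral => A mA AD.
by rewrite /giry_restr/= /mrestr setIidl.
Qed.

End restricted_subprobability.

Lemma real_ray_measurableE (R : realType) :
  @measurable _ (measurableTypeR R) =
  <<s [set A : set R | exists t, A = `]-oo, t]%classic] >>.
Proof.
set G := [set A : set R | _].
rewrite [LHS]RGenOInfty.measurableE eqEsubset; split; last first.
  apply: smallest_sub; first exact: smallest_sigma_algebra.
  move=> _ [t ->]; rewrite -setCitvr.

  apply: measurableC.
  by apply: sub_sigma_algebra; exists t.
apply: smallest_sub; first exact: smallest_sigma_algebra.
move=> _ [t ->]; rewrite -setCitvl.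
apply: (@measurableC _ (g_sigma_algebraType G : algebraOfSetsType _)).
by apply: sub_sigma_algebra; exists t.
Qed.

Lemma giry_eq_ray (R : realType) (mu nu : giry (measurableTypeR R) R) :
  (forall t, mu `]-oo, t]%classic = nu `]-oo, t]%classic) ->
  forall A, measurable A -> mu A = nu A.
Proof.
move=> h A mA.
apply: (@measure_unique _ R (measurableTypeR R)
  [set A : set R | exists t, A = `]-oo, t]%classic]
  (fun n => `]-oo, n%:R]%classic) _ _ _ _ mu nu) => //.
- exact: real_ray_measurableE.
- move=> _ _ [s ->] [t ->]; exists (Num.min s t).
  by apply/seteqP; split => x /=; rewrite !in_itv/= le_min => /andP.
- by move=> n; exists n%:R.
- apply/seteqP; split => // x _; exists (Num.truncn `|x|).+1 => //=.
  by rewrite in_itv/= (le_trans (ler_norm x))// ltW// truncnS_gt.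
- by move=> _ [t ->]; exact: h.
- by move=> n; rewrite ltey_eq fin_num_measure.
Qed.

Lemma giry_eq_rect d1 d2 (T1 : measurableType d1) (T2 : measurableType d2)
    (R : realType) (mu nu : giry (T1 * T2)%type R) :
  (forall A B, measurable A -> measurable B -> mu (A `*` B) = nu (A `*` B)) ->
  forall D, measurable D -> mu D = nu D.
Proof.
move=> h D mD.
apply: (@measure_unique _ R (T1 * T2)%type
  [set A `*` B | A in measurable & B in measurable] (fun=> setT)
  _ _ _ _ mu nu) => //.
- by rewrite measurable_prod_measurableType.
- move=> _ _ [A1 mA1 [B1 mB1 <-]] [A2 mA2 [B2 mB2 <-]].
  exists (A1 `&` A2); first exact: measurableI.
  by exists (B1 `&` B2); [exact: measurableI|rewrite setXI].
- by move=> _; exists setT => //; exists setT => //; rewrite setXTT.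
- by rewrite bigcup_const.
- by move=> _ [A mA [B mB <-]]; exact: h.
- by move=> n; rewrite ltey_eq fin_num_measure.
Qed.

(** [jump_hold_law] describes times only through rays. Fixing some of the factors, by restricting
    the measure and projecting it, leaves measures on fewer factors, until [giry_eq_ray] applies to
    the time alone. *)
Lemma giry_eq_ray_rect d1 d2 (T1 : measurableType d1) (T2 : measurableType d2)
    (R : realType) (mu nu : giry (T1 * measurableTypeR R * T2)%type R) :
  (forall A t B, measurable A -> measurable B ->
     mu ((A `*` `]-oo, t]) `*` B) = nu ((A `*` `]-oo, t]) `*` B)) ->
  forall D, measurable D -> mu D = nu D.
Proof.
move=> h; apply: giry_eq_rect => E B mE mB.
have mTB : measurable ([set: T1 * measurableTypeR R] `*` B) by exact: measurableX.
have mf := @measurable_fst _ _ (T1 * measurableTypeR R)%type T2.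
have EB (m : giry (T1 * measurableTypeR R * T2)%type R) (E' : set (T1 * measurableTypeR R)) :
    giry_map mf (giry_restr m mTB) E' = m (E' `*` B).
  rewrite /giry_map/= /pushforward /giry_restr/= /mrestr; congr (m _).
  by apply/seteqP; split => [[x y] [/= ? [_ ?]]|[x y] [/= ? ?]].
rewrite -!EB; move: E mE; apply: giry_eq_rect => A I mA mI; rewrite !EB.
have mAB : measurable ((A `*` [set: measurableTypeR R]) `*` B).
  by apply: measurableX => //; exact: measurableX.
have mg : measurable_fun setT
    (fun z : T1 * measurableTypeR R * T2 => z.1.2 : measurableTypeR R).
  by apply: measurableT_comp.
have AIB (m : giry (T1 * measurableTypeR R * T2)%type R) (I' : set (measurableTypeR R)) :
    giry_map mg (giry_restr m mAB) I' = m ((A `*` I') `*` B).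
  rewrite /giry_map/= /pushforward /giry_restr/= /mrestr; congr (m _).
  by apply/seteqP; split => [[[x u] y] [/= ? [[? _] ?]]|[[x u] y] [/= [? ?] ?]].
rewrite -!AIB; move: I mI; apply: giry_eq_ray => t; rewrite !AIB.
exact: h.
Qed.

Lemma measurable_inv_ge0 d (T : measurableType d) (R : realType) (f : T -> R) :
  measurable_fun setT f -> (forall x, 0 <= f x) ->
  measurable_fun setT (fun x => (f x)^-1).
Proof.
move=> mf f0; apply: (eq_measurable_fun (fun x => f x `^ -1)).
  by move=> x _; rewrite powR_inv1.
exact: measurableT_comp (measurable_powR _) mf.
Qed.

Section jump_kernel.
Context d (T : measurableType d) (R : realType).
Variable q : R.-ftker T ~> T.

Definition total_rate (x : T) : R := fine (q x setT).

Lemma total_rate_ge0 x : 0 <= total_rate x.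
Proof. exact: fine_ge0. Qed.

Lemma total_rateE x : q x setT = (total_rate x)%:E.
Proof. by rewrite fineK//; exact: kernel_finite_transition. Qed.

Lemma measurable_total_rate : measurable_fun setT total_rate.
Proof.
by apply: measurableT_comp => //; exact: measurable_kernel.
Qed.

Lemma total_rateV_ge0 x : 0 <= (total_rate x)^-1.
Proof. by rewrite invr_ge0 total_rate_ge0. Qed.

Let jump_law0 (x : T) : set T -> \bar R :=
  mscale (NngNum (total_rateV_ge0 x)) (q x).

HB.instance Definition _ x := Measure.on (jump_law0 x).

Let jump_law0_le1 x : (jump_law0 x setT <= 1)%E.
Proof.
rewrite /jump_law0/= /mscale/= total_rateE -EFinM lee_fin.
have [->|c0] := eqVneq (total_rate x) 0; first by rewrite mulr0.
by rewrite mulVf.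
Qed.

HB.instance Definition _ x :=
  Measure_isSubProbability.Build _ _ R (jump_law0 x) (jump_law0_le1 x).

(* At an absorbing state, [total_rate x = 0] and [jump_law x] is the zero
   measure. *)
Definition jump_law (x : T) : giry T R := jump_law0 x.

Lemma jump_lawE x A : jump_law x A = ((total_rate x)^-1%:E * q x A)%E.
Proof. by []. Qed.

Lemma measurable_jump_law : measurable_fun setT (jump_law : T -> giry T R).
Proof.
apply: measurable_giry_codensity => // B mB.
apply: emeasurable_funM; last exact: measurable_kernel.
apply/measurable_EFinP/measurable_inv_ge0; last exact: total_rate_ge0.
exact: measurable_total_rate.
Qed.

Lemma giry_int_jump_law x (f : T -> \bar R) : measurable_fun setT f ->
  (forall y, 0 <= f y)%E ->
  giry_int (jump_law x) f = ((total_rate x)^-1%:E * \int[q x]_y f y)%E.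
Proof. by move=> mf f0; rewrite /giry_int ge0_integral_mscale. Qed.

Lemma measurable_exp_clock (c : R) :
  measurable_fun setT (fun v : measurableTypeR R => - ln v / c : measurableTypeR R).
Proof.
by apply: measurable_funM => //; apply: measurableT_comp.
Qed.

Definition unif01 : giry (measurableTypeR R) R := uniform_prob (@ltr01 R).

Lemma giry_int_unif01 (f : measurableTypeR R -> \bar R) : measurable_fun setT f ->
  (forall v, 0 <= f v)%E ->
  giry_int unif01 f = (\int[lebesgue_measure]_(v in `[0%R, 1%R]) f v)%E.
Proof.
by move=> mf f0; rewrite /giry_int integral_uniform// subr0 invr1 mul1e.
Qed.

Lemma unif01E A : measurable A -> unif01 A = lebesgue_measure (A `&` `[0, 1]).
Proof.
move=> mA; transitivity (giry_int unif01 (fun v => (\1_A v)%:E)).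
  by rewrite /giry_int integral_indic// setIT.
rewrite giry_int_unif01//; last exact/measurable_EFinP/measurable_indic.
by rewrite integral_indic.
Qed.

(** The exponential law is taken as an image of one fixed uniform law, so that its measurable
    dependence on [c] is that of the sections of a measurable set. For [c = 0] it degenerates to a
    Dirac mass at 0, which is harmless because [jump_law] is then zero. *)
Definition exp_clock (c : R) : giry (measurableTypeR R) R :=
  giry_map (measurable_exp_clock c) unif01.

Lemma exp_clock_ray c t : 0 < c ->
  exp_clock c `]-oo, t]%classic = (if 0 <= t then 1 - expR (- (c * t)) else 0)%:E.
Proof.
move=> c0; rewrite /exp_clock /giry_map/= /pushforward.
set A := _ @^-1` _.
have mA : measurable A.
  by rewrite -[A]setTI; apply: (measurable_exp_clock c).
rewrite unif01E//.
have AE v : 0 < v -> A v = (expR (- (c * t)) <= v) :> Prop.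
  move=> v0; rewrite /A/= in_itv/= ler_pdivrMr// lerNl mulrC.
  by rewrite -(ler_expR (- _)) lnK.
case: ifPn => t0.
  set a := expR _.
  have a0 : 0 < a := expR_gt0 _.
  have a1 : a <= 1 by rewrite /a expR_le1 oppr_le0 mulr_ge0// ltW.
  (* Since [ln 0 = 0] by convention, the point 0 also belongs to [A]; it has measure 0. *)
  have -> : A `&` `[0, 1] = [set 0] `|` `[a, 1]%classic.
    apply/seteqP; split => [v [Av]|v].
      rewrite /= in_itv/= => /andP[]; rewrite le_eqVlt => /predU1P[<-|v0] v1.
        by left.
      by right; rewrite /= in_itv/= v1 andbT; move: Av; rewrite AE.
    move=> [->|]; rewrite /= ?in_itv/=.
      by split; rewrite ?lexx ?ler01// /A/= in_itv/= ln0// oppr0 mul0r.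
    move=> /andP[av v1]; have v0 := lt_le_trans a0 av.
    by split; [rewrite AE|rewrite v1 (ltW v0)].
  rewrite measureU//; last first.
    apply/seteqP; split => // v [/= -> ]; rewrite in_itv/= => /andP[].
    by rewrite leNgt a0.
  transitivity (0 + lebesgue_measure `[a, 1%R]%classic)%E.
    by congr (_ + _)%E; exact: lebesgue_measure_set1.
  rewrite add0e lebesgue_measure_itv/= lte_fin.
  have [|] := ltP a 1; first by rewrite EFinB.
  by move=> a1'; rewrite (_ : a = 1) ?subrr//; apply/le_anti; rewrite a1.
rewrite (_ : _ `&` _ = set0) ?measure0//.
apply/seteqP; split => // v [Av]; rewrite /= in_itv/= => /andP[v0 v1].
move: Av; rewrite /A/= in_itv/=; apply/negP; rewrite -ltNge.
rewrite -ltNge in t0; apply: lt_le_trans t0 _.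
by rewrite divr_ge0 ?(ltW c0)// oppr_ge0 ln_le0.
Qed.

Lemma measurable_clock_of_rate : measurable_fun setT (fun x => exp_clock (total_rate x)).
Proof.
apply: measurable_giry_codensity => // B mB.
have mg : measurable_fun setT
    (fun z : T * measurableTypeR R => - ln z.2 / total_rate z.1 : measurableTypeR R).
  apply: measurable_funM.
    by apply: measurableT_comp => //; apply: measurableT_comp => //; exact: measurable_ln.
  apply: measurable_inv_ge0; last by move=> z; exact: total_rate_ge0.
  by apply: measurableT_comp => //; exact: measurable_total_rate.
have mD : measurable ((fun z : T * measurableTypeR R => - ln z.2 / total_rate z.1) @^-1` B).
  by rewrite -[X in measurable X]setTI; exact: mg.
have := measurable_fun_xsection (unif01 : {finite_measure set _ -> \bar R}) mD.
apply: eq_measurable_fun => x _.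
rewrite /exp_clock /giry_map/= /pushforward; congr (unif01 _).
by apply/seteqP; split => v; rewrite /xsection/= inE.
Qed.

End jump_kernel.

Lemma giry_indicE d (T : measurableType d) (R : realType) (mu : giry T R) A :
  measurable A -> mu A = giry_int mu (fun x => (\1_A x)%:E).
Proof. by move=> mA; rewrite /giry_int integral_indic// setIT. Qed.

Lemma giry_prodE d1 d2 (T1 : measurableType d1) (T2 : measurableType d2)
    (R : realType) (mu : giry T1 R) (nu : giry T2 R) A B :
  measurable A -> measurable B ->
  giry_prod (mu, nu) (A `*` B) = (mu A * nu B)%E.
Proof. exact: product_measure1E. Qed.

Section joint_law.
Context d (T : measurableType d) (R : realType) (H : completeNormedModType R).
Variables (P : probability T R) (q : R.-ftker (borelType H) ~> (borelType H)).
Variables (Y : nat -> T -> borelType H) (W : nat -> T -> \bar R).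
Hypothesis mY : forall n, measurable_fun setT (Y n).
Hypothesis mW : forall n, measurable_fun setT (W n).
Hypothesis W0 : forall n w, (0 <= W n w)%E.
Hypothesis YW_law : jump_hold_law P q Y W.
Variable n : nat.

Definition history_gen : set (set T) :=
  (\bigcup_(k in `I_n.+1) preimage_set_system setT (Y k) measurable)
    `|` (\bigcup_(k in `I_n) preimage_set_system setT (W k) measurable).

(** The sample space with the sigma-algebra of the history: being determined by the history becomes
    measurability on this type, and [P] is transported to it along the identity. *)
Definition historyT := g_sigma_algebraType history_gen.

Lemma measurable_to_history : measurable_fun setT (id : T -> historyT).
Proof.
move=> _ B mB; rewrite setTI.
suff : <<s history_gen >> `<=` @measurable _ T by apply.
apply: smallest_sub; first exact: sigma_algebra_measurable.
by move=> C [[k kn [D mD <-]]|[k kn [D mD <-]]]; [exact: mY|exact: mW].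
Qed.

Lemma measurable_history_state : measurable_fun setT (Y n : historyT -> borelType H).
Proof.
move=> _ B mB; apply: sub_sigma_algebra; left; exists n => /=; first by rewrite ltnSn.
by exists B.
Qed.

Lemma measurable_history_holding k : (k < n)%N ->
  measurable_fun setT (W k : historyT -> \bar R).
Proof.
by move=> kn _ B mB; apply: sub_sigma_algebra; right; exists k => //; exists B.
Qed.

Let D := [set w | (W n w < +oo)%E].

Let mD : measurable D.
Proof.
rewrite -[D]setTI; exact: emeasurable_fun_infty_o.
Qed.

Let jump (w : T) : historyT * measurableTypeR R * borelType H :=
  ((w, fine (W n w)), Y n.+1 w).

Let mjump : measurable_fun setT jump.
Proof.
apply: measurable_fun_pair; last exact: mY.
apply: measurable_fun_pair; first exact: measurable_to_history.
by apply: measurableT_comp => //; exact: mW.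
Qed.

Let joint : giry (historyT * measurableTypeR R * borelType H)%type R :=
  giry_map mjump (giry_restr P mD).

(** Candidate conditional law of the history, the holding time and the next state given the history;
    the Dirac mass keeps the history as a coordinate. It is the zero measure at an absorbing state,
    in agreement with [joint], which discards infinite holding times. *)
Let K (w : historyT) : giry (historyT * measurableTypeR R * borelType H)%type R :=
  giry_prod (giry_prod (giry_ret w, exp_clock (total_rate q (Y n w))),
             jump_law q (Y n w)).

Let mK : measurable_fun setT K.
Proof.
apply: (measurableT_comp measurable_giry_prod).
apply: measurable_fun_pair; last first.
  exact: measurableT_comp (measurable_jump_law q) measurable_history_state.
apply: (measurableT_comp measurable_giry_prod).
apply: measurable_fun_pair; first exact: measurable_giry_ret.
exact: measurableT_comp (measurable_clock_of_rate q) measurable_history_state.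
Qed.

Let mgiry_int_K (h : historyT * measurableTypeR R * borelType H -> \bar R) :
  measurable_fun setT h -> (forall z, 0 <= h z)%E ->
  measurable_fun setT (fun w => giry_int (K w) h).
Proof.
by move=> mh h0; exact: measurableT_comp (measurable_giry_int mh h0) mK.
Qed.

Let PG : giry historyT R := giry_map measurable_to_history P.

Let joint_rect A t B : measurable A -> measurable B ->
  joint ((A `*` `]-oo, t]) `*` B) =
  giry_bind PG mK ((A `*` `]-oo, t]) `*` B).
Proof.
move=> mA mB.
have mAB : measurable ((A `*` `]-oo, t]) `*` B : set (historyT * measurableTypeR R * borelType H)).
  by apply: measurableX => //; apply: measurableX.
have mI := @measurable_indic _ _ R setT _ mAB.
rewrite [RHS]giry_indicE// giry_int_bind//; last exact/measurable_EFinP.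
rewrite giry_int_map//; last first.
- by move=> w; exact: integral_ge0.
- by apply: mgiry_int_K => //; exact/measurable_EFinP.
rewrite [LHS]/= /pushforward /giry_restr/= /mrestr.
have KE w : giry_int (K w) (fun x => (\1_((A `*` `]-oo, t]) `*` B) x)%:E) =
    (\d_w A * exp_clock (total_rate q (Y n w)) `]-oo, t]%classic *
     jump_law q (Y n w) B)%E.
  rewrite -giry_indicE// /K giry_prodE//; last exact: measurableX.
  by rewrite giry_prodE.
transitivity (\int[P]_w (\d_(w : historyT) A *
    exp_clock (total_rate q (Y n w)) `]-oo, t]%classic * jump_law q (Y n w) B))%E;
  last by apply: eq_integral => w _; rewrite -KE.
have jump_law0 w : total_rate q (Y n w) = 0 -> jump_law q (Y n w) B = 0%E.
  by move=> c0; rewrite jump_lawE c0 invr0 mul0e.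
have rate_gt0 w : total_rate q (Y n w) != 0 -> 0 < total_rate q (Y n w).
  by move=> c0; rewrite lt0r c0 total_rate_ge0.
have [t0|t0] := leP 0 t; last first.
  rewrite integral0_eq; last first.
    move=> w _; have [/jump_law0 ->|/rate_gt0 c0] := eqVneq (total_rate q (Y n w)) 0.
      by rewrite mule0.
    by rewrite exp_clock_ray// leNgt t0/= mule0 mul0e.
  rewrite (_ : _ `&` D = set0) ?measure0//; apply/seteqP; split => // w [[[_ /=]]].
  rewrite in_itv/= => Wt _ _; have := le_lt_trans Wt t0.
  by rewrite ltNge fine_ge0.
have := YW_law mA t0 mB.
have -> : A `&` [set w | (W n w <= t%:E)%E] `&` Y n.+1 @^-1` B =
    jump @^-1` ((A `*` `]-oo, t]) `*` B) `&` D.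
  apply/seteqP; split => w; rewrite /jump/D/=.
    move=> [[Aw Wt] Bw]; have Woo : (W n w < +oo)%E := le_lt_trans Wt (ltry _).
    split => //; split => //; split => //; rewrite in_itv/=.
    by rewrite -lee_fin fineK// ge0_fin_numE.
  move=> [[[Aw Wt] Bw] Woo]; split => //; split => //.
  by move: Wt; rewrite in_itv/= -lee_fin fineK// ge0_fin_numE.
move=> ->; rewrite integral_mkcond; apply: eq_integral => w _.
rewrite patchE diracE.
have [wA|wA] := boolP (w \in A); last by rewrite !mul0e.
rewrite mul1e -/(total_rate q (Y n w)).
have [c0|/rate_gt0 c0] := eqVneq (total_rate q (Y n w)) 0.
  by rewrite jump_law0// mule0 /= c0 invr0 !mulr0.
rewrite exp_clock_ray// t0 jump_lawE /= EFinM; congr (_ * _)%E.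
by rewrite mulrC EFinM fineK//; exact: kernel_finite_transition.
Qed.

Definition jump_int (psi : historyT * measurableTypeR R * borelType H -> \bar R)
    (w : T) : \bar R :=
  (\int[lebesgue_measure]_(v in `[0%R, 1%R])
     ((total_rate q (Y n w))^-1%:E *
      \int[q (Y n w)]_y psi (w, - ln v / total_rate q (Y n w), y)%R))%E.

Let jump_intE (psi : historyT * measurableTypeR R * borelType H -> \bar R) w :
  measurable_fun setT psi -> (forall z, 0 <= psi z)%E ->
  giry_int (K w) psi = jump_int psi w.
Proof.
move=> mpsi psi0.
have mF (mu : giry (borelType H) R) : measurable_fun setT
    (fun z : historyT * measurableTypeR R => giry_int mu (fun y => psi (z, y))).
  exact: (measurable_fun_fubini_tonelli_F (m2 := mu)).
have psi_ge0 (mu : giry (borelType H) R) z : (0 <= giry_int mu (fun y => psi (z, y)))%E.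
  exact: integral_ge0.
rewrite giry_int_prod1// giry_int_prod1// giry_int_ret; last first.
  exact: (measurable_fun_fubini_tonelli_F (m2 := exp_clock _)
    (fun z => giry_int _ (fun y => psi (z, y)))).
have mFw (mu : giry (borelType H) R) : measurable_fun setT
    (fun u : measurableTypeR R => giry_int mu (fun y => psi (w, u, y))).
  exact: measurable_fun_pair2 (mF mu).
rewrite giry_int_map// giry_int_unif01; last 2 first.
- exact: (measurableT_comp (mFw _) (measurable_exp_clock _)).
- by move=> v; exact: psi_ge0.
apply: eq_integral => v _; rewrite /comp giry_int_jump_law//.
exact: measurable_fun_pair2 mpsi.
Qed.

Lemma measurable_jump_int psi : measurable_fun setT psi ->
  (forall z, 0 <= psi z)%E -> measurable_fun setT (jump_int psi).
Proof.
move=> mpsi psi0.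
have -> : jump_int psi = (fun w => giry_int (K w) psi) \o (id : T -> historyT).
  by apply/funext => w; rewrite /comp jump_intE.
exact: (measurableT_comp (mgiry_int_K mpsi psi0) measurable_to_history).
Qed.

(** Both sides integrate [psi] against sub-probabilities on a product of three spaces. By
    [jump_hold_law] these agree on products whose time factor is a ray, hence everywhere. *)
Lemma joint_law (psi : historyT * measurableTypeR R * borelType H -> \bar R) :
  measurable_fun setT psi -> (forall z, 0 <= psi z)%E ->
  (\int[P]_(w in [set w | (W n w < +oo)%E]) psi (w, fine (W n w), Y n.+1 w) =
   \int[P]_w jump_int psi w)%E.
Proof.
move=> mpsi psi0.
rewrite -(@ge0_giry_int_restr _ _ _ P _ mD (psi \o jump)); last 2 first.
- exact: (measurableT_comp mpsi mjump).
- by move=> w; exact: psi0.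
rewrite -giry_int_map// -/joint.
have <- : giry_int (giry_bind PG mK) psi = giry_int joint psi.
  apply: eq_measure_integral => A mA _; apply/esym.
  exact: (giry_eq_ray_rect joint_rect).
rewrite giry_int_bind// giry_int_map//; last first.
- by move=> w; exact: integral_ge0.
- exact: mgiry_int_K.
by apply: eq_integral => w _; rewrite /comp jump_intE.
Qed.

End joint_law.

(** For [c > 0] and [v > 0], the clock [- ln v / c] is at most [theta] exactly when [v] is at least
    [expR (- (c * theta))]. For [c = 0] the clock is constantly 0 and the domains no longer match,
    whence the assumption that [phi] then vanishes. *)
Lemma integral_exp_clock_before (R : realType) (c theta : R) (phi : R -> \bar R) :
  0 <= c -> (c = 0 -> forall u, phi u = 0%E) -> measurable_fun setT phi ->
  (\int[lebesgue_measure]_(v in `[0%R, 1%R])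
     ((\1_`]-oo, theta] (- ln v / c))%:E * phi (- ln v / c)%R) =
   \int[lebesgue_measure]_(v in `[expR (- (c * theta)), 1%R])
     phi (- ln v / c)%R)%E.
Proof.
move=> c0 phi0 mphi.
have [cE|cn0] := eqVneq c 0.
  by rewrite !integral0_eq// => v _; rewrite phi0// mule0.
have cgt0 : 0 < c by rewrite lt0r cn0.
have mclock : measurable_fun setT (fun v : R => - ln v / c).
  exact: measurable_exp_clock.
have mfull : measurable_fun setT (fun v : R =>
    (\1_`]-oo, theta] (- ln v / c))%:E * phi (- ln v / c)%R)%E.
  apply: emeasurable_funM.
    apply/measurable_EFinP; apply: measurableT_comp mclock.
    exact: measurable_indic.
  exact: measurableT_comp mphi mclock.
(* The endpoint 0 is removed because [ln] takes its default value there and the equivalence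
   fails. *)
rewrite -[LHS]integral_itv_obnd_cbnd; last exact: measurable_funTS mfull.
rewrite integral_mkcond [RHS]integral_mkcond; apply: eq_integral => v _.
rewrite !patchE !mem_setE !in_itv/=.
set a := expR _; have a0 : 0 < a := expR_gt0 _.
have [v1|v1] := leP v 1; rewrite ?andbF//= !andbT.
have [v0|v0] := ltP 0 v; last first.
  by have /negbTE -> : ~~ (a <= v) by rewrite -ltNge (le_lt_trans v0 a0).
have -> : \1_`]-oo, theta] (- ln v / c) = ((a <= v)%R%:R : R).
  rewrite indicE mem_setE in_itv/= ler_pdivrMr// lerNl mulrC.
  by rewrite -(ler_expR (- _)) lnK.
by case: ifPn => _; rewrite ?mul1e// mul0e.
Qed.

Section before_horizon.
Context d (T : measurableType d) (R : realType) (H : completeNormedModType R).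
Variables (P : probability T R) (q : R.-ftker (borelType H) ~> (borelType H)).
Variables (Y : nat -> T -> borelType H) (W : nat -> T -> \bar R).
Hypothesis mY : forall n, measurable_fun setT (Y n).
Hypothesis mW : forall n, measurable_fun setT (W n).
Hypothesis W0 : forall n w, (0 <= W n w)%E.
Hypothesis YW_law : jump_hold_law P q Y W.
Variable n : nat.

Local Notation hT := (historyT Y W n).
Local Notation rate w := (total_rate q (Y n w)).

Variables (A : set hT) (theta : hT -> R).
Hypothesis mA : measurable A.
Hypothesis mtheta : measurable_fun setT theta.
Variable g : hT * measurableTypeR R * borelType H -> \bar R.
Hypothesis mg : measurable_fun setT g.
Hypothesis g0 : forall z, (0 <= g z)%E.

Definition clock_int (w : T) : \bar R :=
  (\int[lebesgue_measure]_(v in `[expR (- (rate w * theta w)), 1%R])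
     ((rate w)^-1%:E * \int[q (Y n w)]_y g (w, - ln v / rate w, y)%R))%E.

Let psi (z : hT * measurableTypeR R * borelType H) : \bar R :=
  ((\1_A z.1.1)%:E * ((\1_`]-oo, 0] (z.1.2 - theta z.1.1))%:E * g z))%E.

Let mpsi : measurable_fun setT psi.
Proof.
apply: emeasurable_funM.
  apply/measurable_EFinP; apply: measurableT_comp.
    exact: measurable_indic.
  exact: measurableT_comp.
apply: emeasurable_funM => //.
have mu : measurable_fun setT (fun z : hT * measurableTypeR R * borelType H =>
    z.1.2 - theta z.1.1 : measurableTypeR R).
  apply: measurable_funB.
    by apply: measurableT_comp => //.
  by apply: measurableT_comp => //; exact: measurableT_comp.
apply/measurable_EFinP; apply: (measurableT_comp _ mu).
exact: measurable_indic.
Qed.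

Let psi0 z : (0 <= psi z)%E.
Proof. by rewrite !mule_ge0// lee_fin. Qed.

Let jump_int_psi : jump_int q psi = clock_int \_ A.
Proof.
apply/funext => w; rewrite patchE /jump_int /psi /=.
have mgw u : measurable_fun setT (fun y => g (w, u, y)).
  exact: (measurable_fun_pair2 _ mg).
case: ifPn => wA; last first.
  rewrite integral0_eq// => v _; rewrite integral0_eq ?mule0// => y _.
  by rewrite indicE (negbTE wA) mul0e.
have mF : measurable_fun setT (fun u : measurableTypeR R =>
    ((rate w)^-1%:E * \int[q (Y n w)]_y g (w, u, y))%E).
  have := measurable_fun_pair2 (w : hT) (measurable_fun_fubini_tonelli_F
    (m2 := jump_law q (Y n w)) _ mg g0).
  by apply: eq_measurable_fun => u _; rewrite -giry_int_jump_law.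
rewrite /clock_int.
transitivity (\int[lebesgue_measure]_(v in `[0%R, 1%R])
   ((\1_`]-oo, theta w] (- ln v / rate w))%:E *
    ((rate w)^-1%:E * \int[q (Y n w)]_y g (w, - ln v / rate w, y)%R)))%E.
  apply: eq_integral => v _; rewrite muleCA; congr (_ * _)%E.
  rewrite -ge0_integralZl//.
  apply: eq_integral => y _; rewrite indicE wA mul1e; congr (_ * _)%E.
  by rewrite !indicE !mem_setE !in_itv/= subr_le0.
apply: (integral_exp_clock_before _ _ _ mF); first exact: total_rate_ge0.
by move=> c0 u; rewrite c0 invr0 mul0e.
Qed.

Lemma measurable_clock_int : measurable_fun [set: T] (clock_int \_ (A : set T)).
Proof.
have <- : jump_int q psi = clock_int \_ (A : set T) := jump_int_psi.
exact: (measurable_jump_int q mY mW mpsi psi0).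
Qed.

(* [v] uniform on [0, 1] turns into the holding time [- ln v / c], and the law
   of the next state is [q (Y n w) / c]. *)
Lemma joint_law_before :
  (\int[P]_(w in A `&` [set w | (W n w <= (theta w)%:E)%E])
     g (w, fine (W n w), Y n.+1 w) = \int[P]_(w in A) clock_int w)%E.
Proof.
rewrite [RHS]integral_mkcond -jump_int_psi -(@joint_law _ _ _ _ P)//.
rewrite integral_mkcond [RHS]integral_mkcond; apply: eq_integral => w _.
rewrite !patchE in_setI.
have [Wt|Wt] := boolP (W n w <= (theta w)%:E)%E.
  have Woo : (W n w < +oo)%E := le_lt_trans Wt (ltry _).
  rewrite (@mem_set _ [set w | (W n w <= (theta w)%:E)%E] w Wt) andbT.
  rewrite (@mem_set _ [set w | (W n w < +oo)%E] w Woo) /psi /=.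
  rewrite !indicE mem_setE in_itv/= subr_le0.
  have -> : (fine (W n w) <= theta w) by rewrite -lee_fin fineK// ge0_fin_numE.
  by case: ifPn => wA; rewrite ?mul1e// mul0e.
rewrite (@memNset _ [set w | (W n w <= (theta w)%:E)%E] w (negP Wt)) andbF.
have [Woo|Woo] := boolP (W n w < +oo)%E; last first.
  by rewrite (@memNset _ [set w | (W n w < +oo)%E] w (negP Woo)).
rewrite (@mem_set _ [set w | (W n w < +oo)%E] w Woo) /psi /=.
rewrite !indicE mem_setE in_itv/= subr_le0.
by rewrite -lee_fin fineK ?ge0_fin_numE// (negbTE Wt) mul0e mule0.
Qed.

End before_horizon.

Section survival.
Context d (T : measurableType d) (R : realType) (H : completeNormedModType R).
Variables (P : probability T R) (q : R.-ftker (borelType H) ~> (borelType H)).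
Variables (Y : nat -> T -> borelType H) (W : nat -> T -> \bar R).
Hypothesis mY : forall n, measurable_fun setT (Y n).
Hypothesis mW : forall n, measurable_fun setT (W n).
Hypothesis W0 : forall n w, (0 <= W n w)%E.
Hypothesis YW_law : jump_hold_law P q Y W.
Variable n : nat.

Local Notation hT := (historyT Y W n).
Local Notation rate w := (total_rate q (Y n w)).

Lemma history_measurable (A : set hT) : measurable A -> @measurable _ T A.
Proof.
move=> mA; rewrite -[A]setTI.
exact: (@measurable_to_history _ _ _ _ Y W mY mW n measurableT A mA).
Qed.

Lemma history_measurable_fun d' (U : measurableType d') (f : hT -> U) :
  measurable_fun setT f -> measurable_fun [set: T] (f : T -> U).
Proof.
move=> mf.
exact: (measurableT_comp mf (@measurable_to_history _ _ _ _ Y W mY mW n)).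
Qed.

(** Given the history, the holding time exceeds [theta] with probability
    [expR (- (rate w * theta w))]. This is the complement of [joint_law_before], and taking
    complements subtracts integrals; so [h] is first truncated at level [m] by the sets [A_ m], and
    then [m] tends to infinity by monotone convergence. *)
Lemma survival_int_le (A : set hT) (theta h : hT -> R) :
  measurable A -> measurable_fun setT theta -> measurable_fun setT h ->
  (forall w, A w -> 0 <= theta w) -> (forall w, 0 <= h w) ->
  (\int[P]_(w in A `\` [set w : T | (W n w <= (theta w)%:E)%E]) (h w)%:E <=
   \int[P]_(w in A) (expR (- (rate w * theta w)) * h w)%:E)%E.
Proof.
move=> mA mtheta mh theta0 h0.
set B := [set w : T | (W n w <= (theta w)%:E)%E].
have mB : measurable B.
  rewrite -[B]setTI; apply: emeasurable_fun_le => //.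
  by apply/measurable_EFinP; exact: history_measurable_fun.
have mrate : measurable_fun [set: T] (fun w => rate w).
  exact: measurableT_comp (measurable_total_rate q) (mY n).
have mhT : measurable_fun [set: T] (h : T -> R) by exact: history_measurable_fun.
have mthetaT : measurable_fun [set: T] (theta : T -> R).
  exact: history_measurable_fun.
have mexp : measurable_fun [set: T] (fun w => expR (- (rate w * theta w))).
  apply: measurableT_comp => //; apply: measurableT_comp => //.
  exact: measurable_funM.
pose A_ (m : nat) : set hT := A `&` [set w | h w <= m%:R].
have mA_ m : @measurable _ hT (A_ m).
  apply: measurableI => //; rewrite -[X in measurable X]setTI.
  exact: measurable_fun_le.
have mA_T m : @measurable _ T (A_ m) by exact: history_measurable.
have key m : (\int[P]_(w in A_ m `\` B) (h w)%:E =
              \int[P]_(w in A_ m) (expR (- (rate w * theta w)) * h w)%:E)%E.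
  have mg : measurable_fun setT
      (fun z : hT * measurableTypeR R * borelType H => (h z.1.1)%:E).
    by apply/measurable_EFinP; apply: measurableT_comp => //; exact: measurableT_comp.
  have := joint_law_before mY mW W0 YW_law (mA_ m) mtheta mg.
  move=> /(_ (fun z => _)); rewrite -/B => jl.
  have {}jl : (\int[P]_(w in A_ m `&` B) (h w)%:E =
      \int[P]_(w in A_ m) ((1 - expR (- (rate w * theta w))) * h w)%:E)%E.
    rewrite jl; last by move=> z; rewrite lee_fin.
    apply: eq_integral => w /set_mem [Aw _]; rewrite /clock_int /=.
    have c0 := total_rate_ge0 q (Y n w).
    set c := rate w in c0 *; set a := expR _.
    have a1 : a <= 1.
      by rewrite /a expR_le1 oppr_le0 mulr_ge0// theta0.
    have qh : (\int[q (Y n w)]_y (h w)%:E = (c * h w)%:E)%E.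
      rewrite [LHS](integral_cst _ measurableT (h w)%:E).
      by rewrite (total_rateE q (Y n w)) -EFinM mulrC.
    under eq_integral do rewrite qh -EFinM.
    transitivity ((c^-1 * (c * h w))%:E *
        lebesgue_measure (`[a, 1%R]%classic : set (measurableTypeR R)))%E.
      exact: integral_cst.
    rewrite lebesgue_measure_itv/= lte_fin.
    have [c00|cn0] := eqVneq c 0.
      by rewrite c00 mul0r mulr0 mul0e /a c00 mul0r oppr0 expR0 subrr mul0r.
    rewrite mulKf//; have [a1'|a1'] := ltP a 1; first by rewrite -EFinB -EFinM mulrC.
    by have -> : a = 1 by [apply/le_anti; rewrite a1]; rewrite subrr mul0r mule0.
  have mAB : measurable (A_ m `&` B : set T) by exact: measurableI.
  have mADB : measurable (A_ m `\` B : set T) by exact: measurableD.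
  have mhE (D : set T) : measurable_fun D (fun w : T => (h w)%:E).
    by apply: measurable_funTS; exact/measurable_EFinP.
  have fin : (\int[P]_(w in A_ m `&` B) (h w)%:E)%E \is a fin_num.
    rewrite ge0_fin_numE; last by apply: integral_ge0 => w _; rewrite lee_fin.
    apply: (@le_lt_trans _ _ (\int[P]_(w in A_ m `&` B) (cst m%:R%:E) w)%E).
      by apply: ge0_le_integral => // w [[_ /= hm] _]; rewrite lee_fin.
    by rewrite integral_cst// lte_mul_pinfty// ltey_eq fin_num_measure.
  have tot : (\int[P]_(w in A_ m `\` B) (h w)%:E +
      \int[P]_(w in A_ m `&` B) (h w)%:E = \int[P]_(w in A_ m) (h w)%:E)%E.
    rewrite -ge0_integral_setU//.
    - by rewrite setUC setUIDK.
    - by move=> w _; rewrite lee_fin.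
    - by apply/disj_setPS => w [[_ Bw] [_ /Bw]].
  have tot' : (\int[P]_(w in A_ m) (expR (- (rate w * theta w)) * h w)%:E +
      \int[P]_(w in A_ m `&` B) (h w)%:E = \int[P]_(w in A_ m) (h w)%:E)%E.
    rewrite jl -ge0_integralD//.
    - by apply: eq_integral => w _; rewrite -EFinD -mulrDl addrC subrK mul1r.
    - by move=> w _; rewrite lee_fin mulr_ge0// expR_ge0.
    - by apply: measurable_funTS; apply/measurable_EFinP/measurable_funM.
    - move=> w [/theta0 tw _]; rewrite lee_fin mulr_ge0// subr_ge0 expR_le1.
      by rewrite oppr_le0 mulr_ge0// total_rate_ge0.
    - apply: measurable_funTS; apply/measurable_EFinP/measurable_funM => //.
      exact: measurable_funB.
  by rewrite -[LHS](addeK _ fin) tot -tot' addeK.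
have UA : \bigcup_m (A_ m `\` B) = A `\` B.
  apply/seteqP; split => [w [m _ [[Aw _] Bw]]//|w [Aw Bw]].
  exists (Num.truncn (h w)).+1 => //; split => //; split => //=.
  by rewrite ltW// truncnS_gt.
rewrite -UA.
have cv : (\int[P]_(w in A_ m `\` B) (h w)%:E)%E @[m --> \oo] -->
    (\int[P]_(w in \bigcup_m (A_ m `\` B)) (h w)%:E)%E.
  apply: ge0_nondecreasing_set_cvg_integral.
  - move=> m p mp; apply/subsetPset => w [[Aw /= hm] Bw]; split => //; split => //=.
    by rewrite (le_trans hm)// ler_nat.
  - by move=> m; exact: measurableD.
  - by move=> m; apply: measurable_funTS; exact/measurable_EFinP.
  - by move=> m w _; rewrite lee_fin.
rewrite -(cvg_lim _ cv)//; apply: lime_le; first by apply/cvg_ex; eexists; exact: cv.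
apply: nearW => m; rewrite key; apply: ge0_subset_integral => //.
- exact: history_measurable.
- by apply: measurable_funTS; apply/measurable_EFinP/measurable_funM.
- by move=> w _; rewrite lee_fin mulr_ge0// expR_ge0.
- by move=> w [].
Qed.

End survival.

(** * Evolution up to the next jump *)

Section jump_chain.
Context d (T : measurableType d) (R : realType) (H : completeNormedModType R).
Variables (P : probability T R) (q : R.-ftker (borelType H) ~> (borelType H)).
Variables (Y : nat -> T -> borelType H) (W : nat -> T -> \bar R).
Hypothesis mY : forall n, measurable_fun setT (Y n).
Hypothesis mW : forall n, measurable_fun setT (W n).
Hypothesis W0 : forall n w, (0 <= W n w)%E.
Hypothesis YW_law : jump_hold_law P q Y W.

Local Notation hT n := (historyT Y W n).
Local Notation rate n w := (total_rate q (Y n w)).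

Lemma jump_time_recr n w : jump_time W n.+1 w = (jump_time W n w + W n w)%E.
Proof. by rewrite /jump_time big_ord_recr. Qed.

Lemma jump_time_ge0 n w : (0 <= jump_time W n w)%E.
Proof. exact: sume_ge0. Qed.

Lemma measurable_history_jump_time n :
  measurable_fun setT (jump_time W n : hT n -> \bar R).
Proof.
apply: emeasurable_sum => k; apply: measurable_history_holding.
exact: ltn_ord.
Qed.

(* The jumps almost surely avoid [B]; integrating their law over holding times
   at most 1, which have positive probability unless the state is absorbing,
   shows that the rate of jumping into [B] is 0. *)
Lemma bad_jump_null n (B : set (borelType H * borelType H)) : measurable B ->
  {ae P, forall w, (jump_time W n w < +oo)%E -> (W n w < +oo)%E ->
     ~ B (Y n w, Y n.+1 w)} ->
  {ae P, forall w, (jump_time W n w < +oo)%E ->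
     q (Y n w) [set y | B (Y n w, y)] = 0%E}.
Proof.
move=> mB badW.
pose A : set (hT n) := [set w | (jump_time W n w < +oo)%E].
have mA : measurable A.
  rewrite -[A]setTI; apply: emeasurable_fun_infty_o => //.
  exact: measurable_history_jump_time.
have mAT : @measurable _ T A by exact: history_measurable.
pose g (z : hT n * measurableTypeR R * borelType H) : \bar R :=
  (\1_B (Y n z.1.1, z.2))%:E.
have mg : measurable_fun setT g.
  apply/measurable_EFinP; apply: measurableT_comp; first exact: measurable_indic.
  apply: measurable_fun_pair => //.
  have m11 : measurable_fun setT
      (fun z : hT n * measurableTypeR R * borelType H => z.1.1).
    exact: measurableT_comp.
  exact: (measurableT_comp (@measurable_history_state _ _ _ _ Y W n) m11).
have g0 z : (0 <= g z)%E by rewrite lee_fin.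
have mtheta : measurable_fun [set: hT n] (cst 1 : hT n -> R) by [].
have jl := joint_law_before mY mW W0 YW_law mA mtheta mg g0.
have lhs0 : (\int[P]_(w in A `&` [set w | (W n w <= (cst 1 w)%:E)%E])
     g (w, fine (W n w), Y n.+1 w) = 0)%E.
  rewrite (ae_eq_integral (cst 0))//; first by rewrite integral0.
  - apply: measurableI => //; rewrite -[X in measurable X]setTI.
    apply: emeasurable_fun_le => //; exact/measurable_EFinP.
  - apply: measurable_funTS; apply/measurable_EFinP.
    apply: measurableT_comp; first exact: measurable_indic.
    by apply: measurable_fun_pair; exact: mY.
  - move: badW; apply: filterS => w Bw [Aw Ww] /=.
    rewrite /g/= indicE memNset//; apply: Bw => //.
    exact: le_lt_trans Ww (ltry _).
rewrite lhs0 integral_mkcond in jl.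
have mF := measurable_clock_int q mY mW mA mtheta mg g0.
have F0 w : (0 <= (clock_int q (cst 1%R) g \_ (A : set T)) w)%E.
  rewrite patchE; case: ifPn => // _; apply: integral_ge0 => v _.
  by rewrite mule_ge0 ?lee_fin ?total_rateV_ge0//; exact: integral_ge0.
have : ae_eq P setT (clock_int q (cst 1%R) g \_ (A : set T)) (cst 0).
  apply/(ae_eq_integral_abs P measurableT mF).
  rewrite jl; apply: eq_integral => w _; rewrite gee0_abs//.
apply: filterS => w /(_ I) /= Fw Aw.
have mBw : measurable [set y | B (Y n w, y)].
  have -> : [set y | B (Y n w, y)] = xsection B (Y n w).
    by apply/seteqP; split => y; rewrite /xsection/= inE.
  exact: measurable_xsection.
have mle : (q (Y n w) [set y | B (Y n w, y)] <= q (Y n w) setT)%E.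
  by apply: le_measure; rewrite ?inE.
have c0 := total_rate_ge0 q (Y n w).
move: Fw; rewrite patchE (mem_set (Aw : A w)) /clock_int /=.
have [cE|cn0] := eqVneq (rate n w) 0.
  by move=> _; apply/eqP; rewrite -measure_le0 (le_trans mle)// (total_rateE q) cE.
have qB : (\int[q (Y n w)]_y g (w, 0%R, y) = q (Y n w) [set y | B (Y n w, y)])%E.
  transitivity (\int[q (Y n w)]_y (\1_[set y | B (Y n w, y)] y)%:E)%E; last first.
    by rewrite integral_indic// setIT.
  apply: eq_integral => y _; rewrite /g/= !indicE.
  by have -> : ((Y n w, y) \in B) = (y \in [set y | B (Y n w, y)])
    by apply/idP/idP; rewrite !inE.
have -> : (\int[lebesgue_measure]_(v in `[expR (- (rate n w * 1)), 1%R])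
     ((rate n w)^-1%:E * \int[q (Y n w)]_y g (w, - ln v / rate n w, y)%R) =
   (rate n w)^-1%:E * q (Y n w) [set y | B (Y n w, y)] *
   lebesgue_measure (`[expR (- (rate n w * 1)), 1%R]%classic : set (measurableTypeR R)))%E.
  transitivity (\int[lebesgue_measure]_(v in `[expR (- (rate n w * 1)), 1%R])
     ((rate n w)^-1%:E * q (Y n w) [set y | B (Y n w, y)]))%E.
    by apply: eq_integral => v _; congr (_ * _)%E; exact: qB.
  exact: integral_cst.
rewrite lebesgue_measure_itv/= lte_fin mulr1 expR_lt1 oppr_lt0.
have cgt0 : 0 < rate n w by rewrite lt0r cn0.
rewrite cgt0 => /eqP; rewrite -EFinB !mule_eq0 => /orP[/orP[|/eqP//]|].
  by rewrite eqe invr_eq0 (negbTE cn0).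
by rewrite eqe subr_eq0 eq_sym -expR0 => /eqP/expR_inj/eqP; rewrite oppr_eq0 (negbTE cn0).
Qed.

End jump_chain.

Section one_jump.
Context d (T : measurableType d) (R : realType) (H : completeNormedModType R).
Variables (P : probability T R) (q : R.-ftker (borelType H) ~> (borelType H)).
Variables (Y : nat -> T -> borelType H) (W : nat -> T -> \bar R).
Hypothesis mY : forall n, measurable_fun setT (Y n).
Hypothesis mW : forall n, measurable_fun setT (W n).
Hypothesis W0 : forall n w, (0 <= W n w)%E.
Hypothesis YW_law : jump_hold_law P q Y W.
Variables (S : R) (G : R -> borelType H -> R).
Hypothesis mG :
  measurable_fun setT (fun z : measurableTypeR R * borelType H => G z.1 z.2).
Hypothesis G0 : forall t y, 0 <= G t y.

Local Notation hT n := (historyT Y W n).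
Local Notation rate n w := (total_rate q (Y n w)).

Definition jumped n : set T := [set w | (jump_time W n w <= S%:E)%E].

Lemma measurable_history_jumped n : @measurable _ (hT n) (jumped n).
Proof.
rewrite -[jumped n]setTI; apply: emeasurable_fun_le => //.
exact: measurable_history_jump_time.
Qed.

Lemma measurable_jumped n : measurable (jumped n).
Proof. by apply: history_measurable => //; exact: measurable_history_jumped. Qed.

Lemma jumped_fin n w : jumped n w -> jump_time W n w \is a fin_num.
Proof.
move=> jw; rewrite ge0_fin_numE; last exact: jump_time_ge0.
exact: le_lt_trans jw (ltry _).
Qed.

(** This puts the event in the form required by [joint_law_before]: the holding time is compared
    with a threshold known from the history. *)
Lemma jumped_recr n : jumped n.+1 =
  jumped n `&` [set w | (W n w <= (S - fine (jump_time W n w))%:E)%E].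
Proof.
apply/seteqP; split => w; rewrite /jumped/= jump_time_recr => jw.
  have jn : jumped n w by apply: le_trans jw; rewrite leeDl.
  split => //; have := jumped_fin jn => fn.
  by rewrite EFinB fineK// leeBrDr// addeC.
case: jw => jn Wn; have := jumped_fin jn => fn.
by move: Wn; rewrite EFinB fineK// leeBrDr// addeC.
Qed.

Lemma measurable_time_state (tau : T -> R) (n : nat) :
  measurable_fun setT tau -> measurable_fun setT (fun w => G (tau w) (Y n w)).
Proof.
move=> mtau.
have mp : measurable_fun setT (fun w => (tau w : measurableTypeR R, Y n w)).
  by apply: measurable_fun_pair => //; exact: mY.
exact: (measurableT_comp mG mp).
Qed.

(** The paths with at least [n] jumps up to [S] are divided according to whether another jump
    occurs. If not, [survival_int_le] supplies the exponential factor; if so, [joint_law_before]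
    supplies the integral over [v]. The hypothesis is the resulting inequality at a fixed
    history. *)
Lemma one_jump_le n :
  {ae P, forall w, jumped n w ->
     let s := fine (jump_time W n w) in let c := rate n w in
     ((expR (- (c * (S - s))) * G S (Y n w))%:E +
      \int[lebesgue_measure]_(v in `[expR (- (c * (S - s))), 1%R])
        (c^-1%:E * \int[q (Y n w)]_y (G (s - ln v / c) y)%:E) <=
      (G s (Y n w))%:E)%E} ->
  (\int[P]_(w in jumped n `\` jumped n.+1) (G S (Y n w))%:E +
   \int[P]_(w in jumped n.+1) (G (fine (jump_time W n.+1 w)) (Y n.+1 w))%:E <=
   \int[P]_(w in jumped n) (G (fine (jump_time W n w)) (Y n w))%:E)%E.
Proof.
move=> step.
pose tau (w : hT n) : R := fine (jump_time W n w).
pose theta (w : hT n) : R := S - tau w.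
pose h (w : hT n) : R := G S (Y n w).
pose g (z : hT n * measurableTypeR R * borelType H) : \bar R :=
  (G (tau z.1.1 + z.1.2) z.2)%:E.
have mA := @measurable_history_jumped n.
have mtau : measurable_fun setT tau.
  by apply: measurableT_comp => //; exact: measurable_history_jump_time.
have mtheta : measurable_fun setT theta by exact: measurable_funB.
have mh : measurable_fun setT h.
  have mp : measurable_fun setT (fun w : hT n => (S : measurableTypeR R, Y n w)).
    apply: measurable_fun_pair => //.
    exact: (@measurable_history_state _ _ _ _ Y W n).
  exact: (measurableT_comp mG mp).
have mg : measurable_fun setT g.
  apply/measurable_EFinP.
  have mp : measurable_fun setT (fun z : hT n * measurableTypeR R * borelType H =>
      (tau z.1.1 + z.1.2 : measurableTypeR R, z.2)).
    apply: measurable_fun_pair => //; apply: measurable_funD.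
      by apply: (measurableT_comp mtau); exact: measurableT_comp.
    exact: measurableT_comp.
  exact: (measurableT_comp mG mp).
have g0 z : (0 <= g z)%E by rewrite lee_fin.
have theta0 w : jumped n w -> 0 <= theta w.
  by move=> jw; rewrite subr_ge0 -lee_fin fineK//; exact: jumped_fin.
have AE : jumped n.+1 = jumped n `&` [set w : T | (W n w <= (theta w)%:E)%E].
  exact: jumped_recr.
have DE : jumped n `\` jumped n.+1 =
    jumped n `\` [set w : T | (W n w <= (theta w)%:E)%E].
  by rewrite AE setDIr setDv set0U.
have first_le := survival_int_le mY mW W0 YW_law mA mtheta mh theta0 (fun w => G0 S (Y n w)).
have second := joint_law_before mY mW W0 YW_law mA mtheta mg g0.
have mAT := @measurable_jumped n.
have Y1 : (\int[P]_(w in jumped n.+1) (G (fine (jump_time W n.+1 w)) (Y n.+1 w))%:E =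
    \int[P]_(w in jumped n) clock_int q theta g w)%E.
  rewrite -second AE; apply: eq_integral => w /set_mem[jn Wn].
  rewrite /g/= /tau jump_time_recr fineD//; first exact: jumped_fin.
  by rewrite ge0_fin_numE// (le_lt_trans Wn (ltry _)).
have mtauT : measurable_fun [set: T] (fun w : T => tau w).
  exact: (history_measurable_fun mY mW mtau).
have mrate : measurable_fun [set: T] (fun w => rate n w).
  exact: measurableT_comp (measurable_total_rate q) (mY n).
have msurv : measurable_fun (jumped n)
    (fun w : T => (expR (- (rate n w * theta w)) * h w)%:E).
  apply: measurable_funTS; apply/measurable_EFinP; apply: measurable_funM.
    apply: measurableT_comp => //; apply: measurableT_comp => //.
    by apply: measurable_funM => //; exact: measurable_funB.
  exact: (@measurable_time_state (cst S)).
have surv0 w : jumped n w -> (0 <= (expR (- (rate n w * theta w)) * h w)%:E)%E.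
  by move=> _; rewrite lee_fin; apply: mulr_ge0; [exact: expR_ge0|exact: G0].
have clock0 w : jumped n w -> (0 <= clock_int q theta g w)%E.
  move=> _; apply: integral_ge0 => v _.
  by rewrite mule_ge0 ?lee_fin ?total_rateV_ge0//; exact: integral_ge0.
have mclock : measurable_fun (jumped n) (clock_int q theta g).
  apply/(measurable_restrictT _ mAT).
  exact: (measurable_clock_int q mY mW mA mtheta mg g0).
rewrite Y1 DE; apply: (@le_trans _ _
   (\int[P]_(w in jumped n) ((expR (- (rate n w * theta w)) * h w)%:E +
       clock_int q theta g w))%E).
  by rewrite (ge0_integralD P mAT surv0 msurv clock0 mclock); exact: leeD2r first_le.
have stepAE : {ae P, forall w, jumped n w ->
    ((expR (- (rate n w * theta w)) * h w)%:E + clock_int q theta g w <=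
     (G (tau w) (Y n w))%:E)%E}.
  apply: filterS step => w stepw jw; have := stepw jw; congr (_ + _ <= _)%E.
  apply: eq_integral => v _; congr (_ * _)%E; apply: eq_integral => y _.
  by rewrite /g /= mulNr.
have sum0 w : jumped n w ->
    (0 <= (expR (- (rate n w * theta w)) * h w)%:E + clock_int q theta g w)%E.
  by move=> jw; exact: (adde_ge0 (surv0 w jw) (clock0 w jw)).
have G0n w : jumped n w -> (0 <= (G (tau w) (Y n w))%:E)%E by rewrite lee_fin.
have mGn : measurable_fun (jumped n) (fun w : T => (G (tau w) (Y n w))%:E).
  by apply: measurable_funTS; apply/measurable_EFinP; exact: measurable_time_state.
exact: (ae_ge0_le_integral mAT sum0 (emeasurable_funD msurv mclock) G0n mGn stepAE).
Qed.

End one_jump.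

(** * The Lyapunov function along the jump process *)

Lemma measurable_superlevel d (T : measurableType d) (R : realType) (f : T -> R)
  (a : R) : measurable_fun setT f -> measurable [set x | a < f x].
Proof.
move=> mf; rewrite -[X in measurable X]setTI.
have := mf measurableT _ (measurable_itv `]a, +oo[).
by congr measurable; congr (_ `&` _); apply/seteqP; split => x /=; rewrite in_itv/= andbT.
Qed.

Section joint_measurability.
Variables (R : realType) (H : completeNormedModType R).
Variable Xt : R -> H.
Hypothesis cXt : continuous Xt.

Lemma measurable_dist_point (a : H) :
  measurable_fun setT (fun y : borelType H => `|(y : H) - a|).
Proof.
apply: (continuous_borel_measurable (f := fun y : H => `|y - a|)) => y.
by apply: cvg_norm; apply: cvgB; [exact: cvg_id|exact: cvg_cst].
Qed.

(* [H] need not be separable, so that addition need not be measurable on the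
   product of the Borel sigma-algebras; only the continuity of [Xt] makes this
   work. *)
Lemma measurable_dist_path :
  measurable_fun setT (fun z : measurableTypeR R * borelType H => `|(z.2 : H) - Xt z.1|).
Proof.
apply: (measurability _ (RGenInftyO.measurableE R)).
move=> _ [_ [r ->] <-]; rewrite setTI.
(* A sublevel set becomes a countable union of rectangles: [Xt t] is approximated within [e] by the
   path at a rational time [p], and [y] is compared with that fixed point. *)
pose F (p e : rat) : set (measurableTypeR R * borelType H) :=
  [set t | `|Xt t - Xt (ratr p)| < ratr e] `*`
  [set y : borelType H | `|(y : H) - Xt (ratr p)| < r - ratr e].
have -> : (fun z : measurableTypeR R * borelType H => `|(z.2 : H) - Xt z.1|) @^-1`
    `]-oo, r[ = \bigcup_p \bigcup_e F p e.
  apply/seteqP; split => [[t y]/=|[t y] [p _] [e _] [/= tp yp]]; rewrite in_itv/=.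
    move=> yt; have [e ye er] : exists2 e : rat, 0 < (ratr e : R) &
        ratr e < (r - `|y - Xt t|) / 2.
      have [] := @rat_in_itvoo R 0 ((r - `|y - Xt t|) / 2).
        by rewrite divr_gt0// subr_gt0.
      by move=> e; rewrite in_itv/= => /andP[]; exists e.
    have o : open [set s | `|Xt t - Xt s| < ratr e].
      apply: (open_comp (f := fun s => `|Xt t - Xt s|) (D := [set u | u < ratr e])).
        move=> s _; apply: cvg_norm; apply: cvgB; [exact: cvg_cst|exact: cXt].
      exact: open_lt.
    have [|s [/= ts [p _ ps]]] := dense_rat _ o.
      by exists t; rewrite /= subrr normr0.
    exists p => //; exists e => //; split => /=; rewrite ps//.
    have : `|y - Xt s| <= `|y - Xt t| + `|Xt t - Xt s| by exact: ler_distD.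
    lra.
  have : `|y - Xt t| <= `|y - Xt (ratr p)| + `|Xt (ratr p) - Xt t| by exact: ler_distD.
  rewrite (distrC (Xt (ratr p))); lra.
apply: bigcupT_measurable_rat => p; apply: bigcupT_measurable_rat => e.
apply: measurableX.
  apply: open_measurable.
  apply: (open_comp (f := fun s => `|Xt s - Xt (ratr p)|) (D := [set u | u < ratr e])).
    move=> s _; apply: cvg_norm; apply: cvgB; [exact: cXt|exact: cvg_cst].
  exact: open_lt.
rewrite -[X in measurable X]setTI.
have := measurable_dist_point (Xt (ratr p)) measurableT
  (measurable_itv `]-oo, (r - ratr e)[).
by congr measurable; congr (_ `&` _); apply/seteqP; split => y /=; rewrite in_itv.
Qed.

Lemma measurable_lyap (lam C : R -> R) : continuous lam -> continuous C ->
  (forall t, 0 < lam t) ->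
  measurable_fun setT (fun z : measurableTypeR R * borelType H =>
    lyap lam C Xt z.1 z.2).
Proof.
move=> clam cC lam0.
have mlam : measurable_fun setT (lam : measurableTypeR R -> R).
  exact: continuous_measurable_fun.
have mC : measurable_fun setT (C : measurableTypeR R -> R).
  exact: continuous_measurable_fun.
have mr : measurable_fun setT (fun z : measurableTypeR R * borelType H =>
    `|lam z.1 *: ((z.2 : H) - Xt z.1)|).
  have -> : (fun z : measurableTypeR R * borelType H =>
      `|lam z.1 *: ((z.2 : H) - Xt z.1)|) =
      (fun z => lam z.1 * `|(z.2 : H) - Xt z.1|).
    by apply/funext => z; rewrite normrZ gtr0_norm.
  apply: measurable_funM measurable_dist_path.
  exact: measurableT_comp mlam _.
rewrite /lyap/cosh2; apply: measurable_funM.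
  apply: measurable_funD; first exact: measurableT_comp.
  by apply: measurableT_comp => //; exact: measurableT_comp.
apply: measurableT_comp => //; apply: measurableT_comp => //.
exact: measurableT_comp mC _.
Qed.

Lemma measurable_kernel_int (q : R.-ftker (borelType H) ~> (borelType H))
    (x : borelType H) (f : measurableTypeR R * borelType H -> \bar R) :
  measurable_fun setT f -> (forall z, 0 <= f z)%E ->
  measurable_fun setT (fun t : measurableTypeR R => \int[q x]_y f (t, y))%E.
Proof.
move=> mf f0.
have mg : measurable_fun setT
    (fun t : measurableTypeR R => giry_int (jump_law q x) (fun y => f (t, y))).
  exact: (measurable_fun_fubini_tonelli_F (m2 := jump_law q x)).
have mft t : measurable_fun setT (fun y => f (t, y)) by exact: measurable_fun_pair2 mf.
have [c0|c0] := eqVneq (total_rate q x) 0.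
  have q0 : q x setT = 0%E by rewrite (total_rateE q) c0.
  apply: (eq_measurable_fun (cst 0%E)) => // t _; apply/esym.
  exact: null_set_integral.
apply: (eq_measurable_fun (fun t : measurableTypeR R => (total_rate q x)%:E *
    giry_int (jump_law q x) (fun y => f (t, y)))%E); last exact: emeasurable_funM.
move=> t _; rewrite giry_int_jump_law// muleA -EFinM divff// mul1e//.
Qed.

End joint_measurability.

(** * The weight and the origin of the constants *)

Section weights.
Variables (R : realType) (kappa T lambda : R).
Hypotheses (T0 : 0 <= T) (lambda0 : 0 < lambda).

(** This is the solution of [lam' = kappa * lam] with value [lambda] at [T]; its value at 0 is the
    factor in front of the initial distance in the theorem. *)
Definition weight (t : R) : R := lambda * expR (- kappa * (T - t)).

Lemma weight_gt0 t : 0 < weight t.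
Proof. by rewrite mulr_gt0// expR_gt0. Qed.

Lemma is_derive_weight (t : R) : is_derive t 1 weight (kappa * weight t).
Proof.
rewrite /weight; apply: is_derive_eq.
by rewrite /GRing.scale/=; ring.
Qed.

(** The exponent of the weight is at most [neg_part kappa * T]; doubling this nonnegative bound
    gives the exponent in the theorem. *)
Lemma weight_le t : 0 <= t -> t <= T ->
  weight t <= lambda * expR (2 * neg_part kappa * T).
Proof.
move=> t0 tT; rewrite ler_pM2l// ler_expR.
have n0 : 0 <= neg_part kappa by rewrite le_max lexx orbT.
have nk : - kappa <= neg_part kappa by rewrite le_max lexx.
apply: (@le_trans _ _ (neg_part kappa * (T - t))).
  by rewrite ler_wpM2r// subr_ge0.
have : 0 <= neg_part kappa * t by exact: mulr_ge0.
have : 0 <= neg_part kappa * T by exact: mulr_ge0.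
lra.
Qed.

(** The factor [e1] arises because the integral of [expR (- 2 * kappa * (T - t))] over [0, T] is
    [e1 (- 2 * kappa * T) * T]. The exponential primitive divides by [kappa], so [kappa = 0]
    receives a linear one. *)
Lemma ex_weight_sqr_primitive (K : R) : exists C : R -> R,
  (forall t : R, is_derive t 1 C (K * weight t ^+ 2)) /\
  C T - C 0 = lambda ^+ 2 * K * e1 (- 2 * kappa * T) * T.
Proof.
have [k0|k0] := eqVneq kappa 0.
  exists (fun t => K * lambda ^+ 2 * t); split => [t|].
    apply: is_derive_eq.
    by rewrite /weight k0 oppr0 mul0r expR0 /GRing.scale/=; ring.
  have -> : - 2 * kappa * T = 0 by rewrite k0; ring.
  by rewrite /e1 eqxx; ring.
exists (fun t => K * lambda ^+ 2 / (2 * kappa) * expR (- (2 * kappa) * (T - t))).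
split => [t|].
  apply: is_derive_eq.
  rewrite /weight exprMn expr2 -[X in _ = _ * (_ * X)]expRD.
  have -> : - kappa * (T - t) + - kappa * (T - t) = - (2 * kappa) * (T - t) by ring.
  rewrite /GRing.scale/=; field; exact: k0.
have [T00|T00] := eqVneq T 0; first by rewrite T00; ring.
rewrite subrr mulr0 expR0 subr0 /e1.
have -> : - 2 * kappa * T = - (2 * kappa) * T by ring.
have kT : - (2 * kappa) * T != 0.
  by rewrite mulf_neq0// oppr_eq0 mulf_neq0// pnatr_eq0.
rewrite (negbTE kT).
by field; rewrite T00 k0.
Qed.

End weights.

(** For a fixed [y], exceeding [L] strictly is an open condition on the time. Hence a jump that is
    excessive at time [t] is so at some rational time, and the set lies in a countable union of null
    sets. *)
Lemma null_bad_jump_rat (R : realType) (H : completeNormedModType R)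
    (mu : {measure set (borelType H) -> \bar R}) (Xt : R -> H) (x : H) (L : R) :
  continuous Xt ->
  (forall p : rat, mu [set y : borelType H |
     L < `| `|(y : H) - Xt (ratr p)| - `|x - Xt (ratr p)| |] = 0%E) ->
  forall t, mu [set y : borelType H | L < `| `|(y : H) - Xt t| - `|x - Xt t| |] = 0%E.
Proof.
move=> cXt mu0 t.
have mB s : measurable [set y : borelType H | L < `| `|(y : H) - Xt s| - `|x - Xt s| |].
  apply: measurable_superlevel.
  apply: measurableT_comp => //; apply: measurable_funB => //.
  exact: measurable_dist_point.
apply: (measure_negligible (mB t)).
apply: (negligibleS (A := \bigcup_(p : rat) [set y : borelType H |
     L < `| `|(y : H) - Xt (ratr p)| - `|x - Xt (ratr p)| |])); last first.
  have -> : \bigcup_(p : rat) [set y : borelType H |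
     L < `| `|(y : H) - Xt (ratr p)| - `|x - Xt (ratr p)| |] =
     \bigcup_(n : nat) (if unpickle n is Some p then [set y : borelType H |
     L < `| `|(y : H) - Xt (ratr p)| - `|x - Xt (ratr p)| |] else set0).
    apply/seteqP; split => [y [p _ py]|y [n _]].
      by apply: (ex_intro2 _ _ (pickle p) I); rewrite pickleK; exact: py.
    by case: unpickle => // p py; exists p.
  apply: negligible_bigcup => n; case: unpickle => [p|]; last exact: negligible_set0.
  exact: (proj2 (negligibleP mu (mB (ratr p))) (mu0 p)).
move=> y /= Ly.
have o : open [set s | L < `| `|y - Xt s| - `|x - Xt s| |].
  apply: (open_comp (f := fun s => `| `|y - Xt s| - `|x - Xt s| |) (D := [set u | L < u])).
    move=> s _; apply: cvg_norm; apply: cvgB; apply: cvg_norm;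
      by apply: cvgB; [exact: cvg_cst|exact: cXt].
  exact: open_gt.
have [|s [/= ys [p _ ps]]] := dense_rat _ o; first by exists t.
by exists p => //=; rewrite ps.
Qed.

Section lyapunov_step.
Variables (R : realType) (H : completeNormedModType R).
Variables (dot : {dot H for @idfun R}) (Hdot : hilbert_dot dot).
Variables (q : R.-ftker (borelType H) ~> (borelType H)).
Variables (LI : H -> H) (cLI : continuous LI) (kappa : R).
Hypothesis HLI : is_vgen q (fun x : H => x) LI.
Hypothesis LI_diss : forall x y : H,
  dot (x - y) (LI x - LI y) <= - kappa * `|x - y| ^+ 2.
Variables (V M L T : R).
Hypothesis M0 : 0 <= M.
Hypothesis HV : forall x : H, (gen q (fun y : H => `|y - x| ^+ 2)%R x <= V%:E)%E.
Variables (lam C : R -> R) (Xt : R -> H).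
Hypothesis lam_gt0 : forall t, 0 < lam t.
Hypothesis lamP : forall t : R, is_derive t 1 lam (kappa * lam t).
Hypothesis CP : forall t : R, is_derive t 1 C (e2 M * V * lam t ^+ 2).
Hypothesis XtP : forall t : R, is_derive t 1 Xt (LI (Xt (Num.max 0 t))).
Hypothesis lamM : forall t, 0 <= t -> t <= T -> lam t * L <= M.

Lemma lyap_step_le (x : borelType H) (s c : R) : c = total_rate q x -> 0 <= s -> s <= T ->
  (forall t, q x [set y : borelType H |
     L < `| `|(y : H) - Xt t| - `|(x : H) - Xt t| |] = 0%E) ->
  ((expR (- (c * (T - s))) * lyap lam C Xt T x)%:E +
   \int[lebesgue_measure]_(v in `[expR (- (c * (T - s))), 1%R])
     (c^-1%:E * \int[q x]_y (lyap lam C Xt (s - ln v / c) y)%:E) <=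
   (lyap lam C Xt s x)%:E)%E.
Proof.
move=> cE s0 sT bad0.
have cts (E : normedModType R) (f df : R -> E) :
    (forall t : R, is_derive t 1 f (df t)) -> continuous f.
  by move=> fP t; exact/differentiable_continuous/derivable1_diffP/ex_derive.
have lyap0 (z : measurableTypeR R * borelType H) :
    (0 <= (lyap lam C Xt z.1 z.2)%:E)%E.
  by rewrite lee_fin ltW// lyap_gt0.
have mly : measurable_fun setT (fun z : measurableTypeR R * borelType H =>
    (lyap lam C Xt z.1 z.2)%:E).
  apply/measurable_EFinP; apply: measurable_lyap => //.
  - exact: cts XtP.
  - exact: cts lamP.
  - exact: cts CP.
apply: (integral_exp_clock_le (f := fun t => lyap lam C Xt t x)
  (df := fun t => dlyap dot LI kappa lam C (e2 M * V) Xt t x)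
  (h := fun t => (\int[q x]_y (lyap lam C Xt t y)%:E)%E)) => //.
- by rewrite cE total_rate_ge0.
- by move=> t; exact: is_derive_lyap.
- exact: continuous_dlyap.
- exact: (measurable_kernel_int q x mly).
move=> t /andP[st tT]; apply/andP; split.
  by apply: integral_ge0 => y _; exact: (lyap0 (t, y)).
have t0 : 0 <= t := le_trans s0 st.
rewrite cE.
exact: (generator_lyap_le Hdot HLI LI_diss M0 HV C lam_gt0 t0 (lamM t0 tT) (bad0 t)).
Qed.

End lyapunov_step.

(** * Sample paths of the jump process *)

Section paths.
Context d (T : measurableType d) (R : realType) (H : completeNormedModType R).
Variables (P : probability T R) (q : R.-ftker (borelType H) ~> (borelType H)).
Variables (Y : nat -> T -> borelType H) (W : nat -> T -> \bar R).
Hypothesis mY : forall n, measurable_fun setT (Y n).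
Hypothesis mW : forall n, measurable_fun setT (W n).
Hypothesis W0 : forall n w, (0 <= W n w)%E.
Hypothesis YW_law : jump_hold_law P q Y W.
Hypothesis W_nonexplosive : {ae P, forall w, jump_time W n w @[n --> \oo] --> +oo%E}.
Variable Xh : R -> T -> borelType H.
Hypothesis mXh : forall t, 0 <= t -> measurable_fun setT (Xh t).
Hypothesis Xh_path : {ae P, forall w, forall (n : nat) (t : R),
  (jump_time W n w <= t%:E < jump_time W n.+1 w)%E -> Xh t w = Y n w}.

(** This is [jump_hold_law] at time 0. It makes every interval between successive jump times
    nondegenerate, so that each state is really taken by the path. *)
Lemma holding_gt0 : {ae P, forall w, forall n, (0 < W n w)%E}.
Proof.
apply/ae_foralln => n.
have mN : measurable [set w | (W n w <= 0)%E].
  rewrite -[X in measurable X]setTI; exact: emeasurable_fun_infty_c.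
exists [set w | (W n w <= 0)%E]; split => //; last first.
  by move=> w /= /negP; rewrite -leNgt.
have hT : history Y W n setT by exact: (@measurableT _ (historyT Y W n)).
have := YW_law hT (lexx 0) measurableT.
rewrite setTI setIT => Pn; apply: (etrans Pn); apply: integral0_eq => w _ /=.
by rewrite mulr0 oppr0 expR0 subrr mul0r.
Qed.

Lemma jump_timeS_gt w n : (forall n, (0 < W n w)%E) ->
  (jump_time W n w < +oo)%E -> (jump_time W n w < jump_time W n.+1 w)%E.
Proof.
move=> Wgt0 jn; rewrite jump_time_recr lteDl ?Wgt0// ge0_fin_numE//.
exact: jump_time_ge0.
Qed.

(** The path equals [Y n] on a nondegenerate interval ending at the next jump time, so [Y n] is its
    left limit there, and its value there is [Y n.+1]. *)
Lemma jump_amplitude_le (L : R) n : jumps_bounded P Xh L ->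
  {ae P, forall w, (jump_time W n w < +oo)%E -> (W n w < +oo)%E ->
     `|(Y n.+1 w : H) - Y n w| <= L}.
Proof.
move=> XL; near=> w => jn Wn.
have Wgt0 : forall n, (0 < W n w)%E by near: w; exact: holding_gt0.
have path : forall (n : nat) (t : R),
  (jump_time W n w <= t%:E < jump_time W n.+1 w)%E -> Xh t w = Y n w by near: w.
have bound : forall (t : R) (l : H), 0 < t ->
    (Xh s w : H) @[s --> t^'-] --> l -> `|(Xh t w : H) - l| <= L by near: w.
have jfin : jump_time W n w \is a fin_num.
  by rewrite ge0_fin_numE//; exact: jump_time_ge0.
have jSoo : (jump_time W n.+1 w < +oo)%E by rewrite jump_time_recr lte_add_pinfty.
have jSfin : jump_time W n.+1 w \is a fin_num.
  by rewrite ge0_fin_numE//; exact: jump_time_ge0.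
have jlt := jump_timeS_gt Wgt0 jn.
have <- : Xh (fine (jump_time W n.+1 w)) w = Y n.+1 w.
  by apply: path; rewrite fineK// lexx jump_timeS_gt.
set t := fine _.
have t0 : fine (jump_time W n w) < t by rewrite fine_lt.
have tgt0 : 0 < t by apply: le_lt_trans t0; rewrite fine_ge0// jump_time_ge0.
apply: (bound _ _ tgt0); apply: cvg_near_cst.
near=> s; apply: path; apply/andP; split.
  rewrite -(fineK jfin) lee_fin; near: s; exact: nbhs_left_ge.
rewrite -(fineK jSfin) lte_fin; near: s; exact: nbhs_left_lt.
Unshelve. all: by end_near. Qed.

(** At a time inside the first holding interval the path is locally constant on the left, so the
    amplitude that [L] bounds is 0. This argument also covers a process that never jumps. *)
Lemma jump_bound_ge0 (L : R) : jumps_bounded P Xh L -> 0 <= L.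
Proof.
move=> XL.
have [w [Wgt0 [path bound]]] : exists w, (forall n, (0 < W n w)%E) /\
  (forall (n : nat) (t : R),
    (jump_time W n w <= t%:E < jump_time W n.+1 w)%E -> Xh t w = Y n w) /\
  (forall (t : R) (l : H), 0 < t ->
    (Xh s w : H) @[s --> t^'-] --> l -> `|(Xh t w : H) - l| <= L).
  have PT : (0 < P [set: T])%E by rewrite probability_setT lte01.
  have FF := ae_properfilter_algebraOfSetsType PT.
  apply: (@filter_ex _ _ FF); near=> w; split; first by near: w; exact: holding_gt0.
  by split; near: w.
have [t t0 tW] : exists2 t : R, 0 < t & (t%:E < W 0%N w)%E.
  have := Wgt0 0%N; case: (W 0%N w) => [r| |//]; last by move=> _; exists 1; rewrite ?ltry.
  by rewrite lte_fin => r0; exists (r / 2); rewrite ?divr_gt0// lte_fin ltr_pdivrMr// ltr_pMr// ltr1n.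
have Xt s : 0 <= s -> s <= t -> Xh s w = Y 0%N w.
  move=> s0 st; apply: path; rewrite /jump_time big_ord0 lee_fin s0 big_ord1.
  by rewrite (le_lt_trans _ tW).
have := bound t (Y 0%N w) t0; rewrite (Xt t (ltW t0) (lexx t)) subrr normr0; apply.
apply: cvg_near_cst; near=> s; apply: Xt.
  near: s; exact: nbhs_left_ge.
near: s; exact: nbhs_left_le.
Unshelve. all: by end_near. Qed.

Lemma initial_state : {ae P, forall w, Xh 0 w = Y 0%N w}.
Proof.
near=> w.
have Wgt0 : forall n, (0 < W n w)%E by near: w; exact: holding_gt0.
have path : forall (n : nat) (t : R),
  (jump_time W n w <= t%:E < jump_time W n.+1 w)%E -> Xh t w = Y n w by near: w.
by apply: path; rewrite /jump_time big_ord0 big_ord1 lexx Wgt0.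
Unshelve. all: by end_near. Qed.

Lemma state_at (S : R) : 0 <= S ->
  {ae P, forall w, exists k,
     (jumped W S k `\` jumped W S k.+1) w /\ Xh S w = Y k w}.
Proof.
move=> S0; near=> w.
have path : forall (n : nat) (t : R),
  (jump_time W n w <= t%:E < jump_time W n.+1 w)%E -> Xh t w = Y n w by near: w.
have toinf : jump_time W n w @[n --> \oo] --> +oo%E by near: w.
have ex : exists n, (S%:E < jump_time W n w)%E.
  have [N _ HN] := (proj1 (cvgeyPgt _)) toinf S.
  by exists N; apply: HN => /=.
have := ex_minnP ex; case=> [[|k]] => [|Sk kmin].
  by rewrite /jump_time big_ord0 lte_fin ltNge S0.
have jk : (jump_time W k w <= S%:E)%E.
  by rewrite leNgt; apply/negP => /kmin; rewrite ltnn.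
exists k; split; first by split => //; rewrite /jumped/=; apply/negP; rewrite -ltNge.
by apply: path; rewrite jk.
Unshelve. all: by end_near. Qed.

(* The initial value dominates every partial sum over [k] of the contributions
   of the paths that have made exactly [k] jumps before [S]. *)
Lemma integral_path_le (S : R) (G : R -> borelType H -> R) : 0 <= S ->
  measurable_fun setT (fun z : measurableTypeR R * borelType H => G z.1 z.2) ->
  (forall t y, 0 <= G t y) ->
  (forall n,
    (\int[P]_(w in jumped W S n `\` jumped W S n.+1) (G S (Y n w))%:E +
     \int[P]_(w in jumped W S n.+1) (G (fine (jump_time W n.+1 w)) (Y n.+1 w))%:E <=
     \int[P]_(w in jumped W S n) (G (fine (jump_time W n w)) (Y n w))%:E)%E) ->
  (\int[P]_w (G S (Xh S w))%:E <= \int[P]_w (G 0 (Xh 0 w))%:E)%E.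
Proof.
move=> S0 mG G0 step.
pose D n := jumped W S n `\` jumped W S n.+1.
pose f n := (fun w => (G S (Y n w))%:E) \_ (D n).
have mj n : measurable (jumped W S n) by exact: measurable_jumped.
have mD n : measurable (D n) by exact: measurableD.
have mGY (t : R) (Z : T -> borelType H) : measurable_fun setT Z ->
    measurable_fun setT (fun w => (G t (Z w))%:E).
  move=> mZ; apply/measurable_EFinP.
  have mp : measurable_fun setT (fun w => (t : measurableTypeR R, Z w)).
    exact: measurable_fun_pair.
  exact: (measurableT_comp mG mp).
have f0 n w : (0 <= f n w)%E.
  by rewrite /f patchE; case: ifPn => // _; rewrite lee_fin.
have mf n : measurable_fun setT (f n).
  by apply/(measurable_restrictT _ (mD n)); apply: measurable_funTS; exact: mGY.
have partial n : (\sum_(0 <= k < n) \int[P]_w f k w +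
   \int[P]_(w in jumped W S n) (G (fine (jump_time W n w)) (Y n w))%:E <=
   \int[P]_(w in jumped W S 0) (G (fine (jump_time W 0 w)) (Y 0%N w))%:E)%E.
  elim: n => [|n IH]; first by rewrite big_geq// add0e.
  rewrite big_nat_recr//= -addeA; apply: le_trans IH; apply: leeD2l.
  by rewrite /f -integral_mkcond; exact: step.
apply: (@le_trans _ _ (\sum_(0 <= k <oo) \int[P]_w f k w)%E).
  rewrite -integral_nneseries//; apply: ae_ge0_le_integral => //.
  - by move=> w _; rewrite lee_fin.
  - exact: (mGY S (Xh S) (mXh S0)).
  - by move=> w _; exact: nneseries_ge0.
  - exact: ge0_emeasurable_sum.
  - apply: filterS (state_at S0) => w [k [Dk ->]] _.
    apply: (@le_trans _ _ (\sum_(0 <= i < k.+1) f i w)%E); last exact: nneseries_lim_ge.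
    rewrite big_nat_recr//= [in leRHS]/f patchE mem_set// leeDr//.
    by apply: sume_ge0 => i _; exact: (f0 i w).
apply: (@le_trans _ _
    (\int[P]_(w in jumped W S 0) (G (fine (jump_time W 0 w)) (Y 0%N w))%:E)%E).
  apply: lime_le.
    by apply: is_cvg_nneseries => n _ _; exact: integral_ge0.
  apply: nearW => n; apply: le_trans (partial n); rewrite leeDl//.
  by apply: integral_ge0 => w _; rewrite lee_fin.
have -> : jumped W S 0 = setT.
  by apply/seteqP; split => // w _; rewrite /jumped/= /jump_time big_ord0 lee_fin.
have t0 w : fine (jump_time W 0 w) = 0 by rewrite /jump_time big_ord0.
under eq_integral do rewrite t0.
apply: ae_ge0_le_integral => //.
- by move=> w _; rewrite lee_fin.
- exact: (mGY 0 (Y 0%N) (mY 0%N)).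
- by move=> w _; rewrite lee_fin.
- exact: (mGY 0 (Xh 0) (mXh (lexx 0))).
- by apply: filterS initial_state => w ->.
Qed.

End paths.

Lemma ae_forall_rat d (T : measurableType d) (R : realType) (P : probability T R)
    (Q : rat -> T -> Prop) :
  (forall p, {ae P, forall w, Q p w}) -> {ae P, forall w, forall p, Q p w}.
Proof.
move=> aeQ.
have : {ae P, forall w, forall n : nat, forall p, unpickle n = Some p -> Q p w}.
  apply/ae_foralln => n; case: (unpickle n) => [p|]; last exact: aeW.
  by apply: filterS (aeQ p) => w Qw p' [<-].
by apply: filterS => w Qw p; apply: (Qw (pickle p)); rewrite pickleK.
Qed.

(** The set [B a] concerns one fixed centre [a], hence is measurable, and the triangle inequality
    keeps the actual jumps out of it. Countably many centres, the points of [Xt] at rational times,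
    yield a single null set valid for all [t]. *)
Lemma ae_null_bad_jump d (T : measurableType d) (R : realType)
    (H : completeNormedModType R) (P : probability T R)
    (q : R.-ftker (borelType H) ~> (borelType H))
    (Y : nat -> T -> borelType H) (W : nat -> T -> \bar R) (L : R) (Xt : R -> H)
    (n : nat) :
  (forall n, measurable_fun setT (Y n)) ->
  (forall n, measurable_fun setT (W n)) -> (forall n w, (0 <= W n w)%E) ->
  jump_hold_law P q Y W -> continuous Xt ->
  {ae P, forall w, (jump_time W n w < +oo)%E -> (W n w < +oo)%E ->
     `|(Y n.+1 w : H) - Y n w| <= L} ->
  {ae P, forall w, (jump_time W n w < +oo)%E -> forall t,
     q (Y n w) [set y : borelType H |
       L < `| `|(y : H) - Xt t| - `|(Y n w : H) - Xt t| |] = 0%E}.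
Proof.
move=> mY mW W0 YW_law cXt amp.
pose B (a : H) : set (borelType H * borelType H) :=
  [set z | L < `| `|(z.2 : H) - a| - `|(z.1 : H) - a| |].
have mB a : measurable (B a).
  apply: measurable_superlevel; apply: measurableT_comp => //.
  by apply: measurable_funB; apply: (measurableT_comp (measurable_dist_point a)).
have badB a : {ae P, forall w, (jump_time W n w < +oo)%E ->
    q (Y n w) [set y | B a (Y n w, y)] = 0%E}.
  apply: (bad_jump_null mY mW W0 YW_law (mB a)).
  apply: filterS amp => w Yw jn Wn; rewrite /B/=; apply/negP; rewrite -leNgt.
  apply: le_trans (Yw jn Wn); apply: le_trans (ler_dist_dist _ _) _.
  by rewrite opprB addrA subrK.
have := ae_forall_rat (fun p => badB (Xt (ratr p))).
apply: filterS => w bad jn t.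
by apply: null_bad_jump_rat => // p; exact: bad p jn.
Qed.

(** * From the decay of the Lyapunov function to the logarithmic bound *)

Unset Implicit Arguments.

Theorem theorem3p3 (R : realType) (H : completeNormedModType R)
    (dot : {dot H for @idfun R}) (Hdot : hilbert_dot dot)
    (d : measure_display) (Omega : measurableType d) (P : probability Omega R)
    (q : R.-ftker (borelType H) ~> (borelType H))
    (Xh : R -> Omega -> borelType H)
    (HXh : jump_markov_process P q Xh)
    (LI : H -> H) (HLI : is_vgen q (fun x : H => x) LI)
    (LI_diff : forall x : H, differentiable LI x)
    (X : R -> H) (HX : solves_ode LI X)
    (kappa : R)
    (Hkappa : forall x h : H, dot ('d LI x h) h <= - kappa * `|h| ^+ 2)
    (L : R) (HL : jumps_bounded P Xh L)
    (V : R)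
    (HV : forall x : H, (gen q (fun y : H => `|y - x| ^+ 2)%R x <= V%:E)%E)
    (T lambda : R) (HT : 0 <= T) (Hlambda : 0 < lambda) :
  (lne 'E_P[(fun w => calU (lambda *: ((Xh T w : H) - X T)))%R] <=
   lne 'E_P[(fun w => calU ((lambda * expR (- kappa * T)) *:
                            ((Xh 0 w : H) - X 0)))%R] +
   (lambda ^+ 2 * e2 (lambda * expR (2 * neg_part kappa * T) * L) *
    e1 (- 2 * kappa * T) * V * T)%:E)%E.
Proof.
have [mXh [Y [W [mY mWW0 YW_law nonexpl path]]]] := HXh.
have mW n := proj1 (mWW0 n); have W0 n := proj2 (mWW0 n).
have cLI : continuous LI by move=> x; exact: differentiable_continuous.
have diss := dissipative_of_diff Hdot LI_diff Hkappa.
have [Xt [XtX XtP]] := solves_ode_extension HX.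
have cXt : continuous Xt.
  by move=> t; exact/differentiable_continuous/derivable1_diffP/ex_derive.
have L0 := jump_bound_ge0 mW YW_law path HL.
set M := lambda * expR (2 * neg_part kappa * T) * L.
have M0 : 0 <= M by rewrite mulr_ge0// mulr_ge0 ?expR_ge0// ltW.
pose lam := weight kappa T lambda.
have lam0 t : 0 < lam t by exact: weight_gt0.
have lamP (t : R) : is_derive t 1 lam (kappa * lam t) by exact: is_derive_weight.
have lamM t : 0 <= t -> t <= T -> lam t * L <= M.
  by move=> t0 tT; rewrite ler_wpM2r// weight_le.
have [C [CP CT]] := ex_weight_sqr_primitive kappa T lambda (e2 M * V).
have mG : measurable_fun setT (fun z : measurableTypeR R * borelType H =>
    lyap lam C Xt z.1 z.2).
  apply: measurable_lyap => // t.
    exact/differentiable_continuous/derivable1_diffP/ex_derive.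
  exact/differentiable_continuous/derivable1_diffP/ex_derive.
have G0 t y : 0 <= lyap lam C Xt t y by exact/ltW/lyap_gt0.
have decay : (\int[P]_w (lyap lam C Xt T (Xh T w))%:E <=
              \int[P]_w (lyap lam C Xt 0 (Xh 0 w))%:E)%E.
  apply: (integral_path_le mY mW YW_law nonexpl mXh path HT mG G0) => n.
  apply: (one_jump_le mY mW W0 YW_law mG G0).
  have amp := jump_amplitude_le mW W0 YW_law path n HL.
  apply: filterS (ae_null_bad_jump mY mW W0 YW_law cXt amp) => w bad jn.
  have jfin := jumped_fin W0 jn.
  apply: (lyap_step_le Hdot cLI HLI diss M0 HV lam0 lamP CP XtP lamM (erefl _)).
  - exact/fine_ge0/jump_time_ge0.
  - by rewrite -lee_fin fineK.
  - by apply: bad; rewrite ltey_eq jfin.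
have lamT : lam T = lambda by rewrite /lam /weight subrr mulr0 expR0 mulr1.
have lam00 : lam 0 = lambda * expR (- kappa * T) by rewrite /lam /weight subr0.
rewrite unlock.
set ET := (\int[P]_w (calU (lambda *: ((Xh T w : H) - X T)))%:E)%E.
set E0 := (\int[P]_w (calU ((lambda * expR (- kappa * T)) *:
                            ((Xh 0 w : H) - X 0)))%:E)%E.
have mU (t : R) (a : R) (b : H) : 0 <= t -> 0 < a ->
    measurable_fun setT (fun w => (calU (a *: ((Xh t w : H) - b)))%:E).
  move=> t0 a0; apply/measurable_EFinP.
  have mu : measurable_fun setT (fun y : borelType H => calU (a *: ((y : H) - b))).
    apply: (continuous_borel_measurable (f := fun y : H => calU (a *: (y - b)))) => y.
    have cn : {for y, continuous (fun y : H => `|a *: (y - b)|)}.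
      apply: cvg_norm; apply: cvgZ; first exact: cvg_cst.
      by apply: cvgB; [exact: cvg_id|exact: cvg_cst].
    apply: cvgD; first by apply: continuous_cvg; [exact: continuous_expR|exact: cn].
    by apply: continuous_cvg; [exact: continuous_expR|apply: cvgN; exact: cn].
  exact: (measurableT_comp mu (mXh t t0)).
have U2 (x : H) : 2 <= calU x by exact: cosh2_ge2.
have a0_gt0 : 0 < lambda * expR (- kappa * T) by rewrite mulr_gt0// expR_gt0.
(* Splitting the logarithm of the product requires a positive [E0], which holds since [calU] is at
   least 2; the value +oo is allowed. *)
have E0_gt0 : (0 < E0)%E.
  apply: (@lt_le_trans _ _ (\int[P]_w (cst 2%:E) w)%E).
    by rewrite integral_cst//= probability_setT mule1 lte_fin.
  apply: ge0_le_integral => //.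
  - by move=> w _; rewrite lee_fin.
  - exact: (mU 0 _ (X 0) (lexx 0) a0_gt0).
  - by move=> w _; rewrite lee_fin.
have ET_ge0 : (0 <= ET)%E.
  by apply: integral_ge0 => w _; rewrite lee_fin; apply: le_trans (U2 _).
have lyapE (t : R) (a : R) : 0 <= t -> 0 < a -> lam t = a ->
    (\int[P]_w (lyap lam C Xt t (Xh t w))%:E =
     (expR (- C t))%:E * \int[P]_w (calU (a *: ((Xh t w : H) - X t)))%:E)%E.
  move=> t0 a0 lta; rewrite -ge0_integralZl//.
  - by apply: eq_integral => w _; rewrite /lyap lta XtX// mulrC.
  - exact: (mU t a (X t) t0 a0).
  - by move=> w _; rewrite lee_fin; apply: le_trans (U2 _).
(* Only the difference [C T - C 0] survives, so the choice of the primitive is immaterial. *)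
have ETle : (ET <= (expR (C T - C 0))%:E * E0)%E.
  move: decay; rewrite (lyapE T lambda)// (lyapE 0 (lambda * expR (- kappa * T)))//.
  rewrite -/ET -/E0 => decay.
  have e0 : (0 <= (expR (C T))%:E :> \bar R)%E by rewrite lee_fin expR_ge0.
  have := lee_wpmul2l e0 decay.
  by rewrite !muleA -!EFinM -!expRD subrr expR0 mul1e.
apply: (@le_trans _ _ (lne ((expR (C T - C 0))%:E * E0))).
  by rewrite lee_lne// in_itv/= ?leey ?andbT// mule_ge0 ?lee_fin ?expR_ge0// ltW.
have e_gt0 : 0 < expR (C T - C 0) := expR_gt0 _.
rewrite lneM; last 2 first.
- by rewrite in_itv/= lte_fin e_gt0 leey.
- by rewrite in_itv/= E0_gt0 leey.
rewrite lne_EFin// expRK CT -/M addeC leeD2l// lee_fin.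
by rewrite le_eqVlt; apply/orP; left; apply/eqP; ring.
Qed.
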